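(* Let $\rho\in W(0,T;\mathbb{H}^s_\Omega)$ be the weak solution of $$\rho_t+(-\Delta)^s\rho=f\ \text{ in } Q,\qquad \mathcal{N}_s\rho+\rho=g\ \text{ in }\Sigma,\qquad \rho(\cdot,0)=\rho_0\ \text{ in }\Omega$$ associated to data $f\in L^2(Q)$, $g\in L^2(\Sigma)$ and $\rho_0\in L^2(\Omega)$, and let $\tilde\rho\in W(0,T;\mathbb{H}^s_\Omega)$ be the weak solution of the same problem with $f,g,\rho_0$ replaced by data $\tilde f\in L^2(Q)$, $\tilde g\in L^2(\Sigma)$ and $\tilde\rho_0\in L^2(\Omega)$. If $\rho_0\le\tilde\rho_0$ almost everywhere in $\Omega$, $g\le\tilde g$ almost everywhere in $\Sigma$ and $f\le\tilde f$ almost everywhere in $Q$, then $\rho\le\tilde\rho$ almost everywhere in $\mathbb{R}^N\times[0,T]$. In particular, if $g\ge 0$, $f\ge 0$ and $\rho_0\ge 0$, then $\rho\ge 0$ almost everywhere in $\mathbb{R}^N\times[0,T]$.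
   Context: Setting: $N\ge 1$, $\Omega\subset\mathbb{R}^N$ is a bounded open domain with Lipschitz continuous boundary, $0<s<1$, $T>0$, $Q=\Omega\times(0,T)$, $\Sigma=(\mathbb{R}^N\setminus\Omega)\times(0,T)$, and $C_{N,s}=\frac{s2^{2s}\Gamma((2s+N)/2)}{\pi^{N/2}\Gamma(1-s)}$. Formally, $(-\Delta)^s w(x)=C_{N,s}\,\mathrm{P.V.}\int_{\mathbb{R}^N}\frac{w(x)-w(y)}{|x-y|^{N+2s}}\,dy$ and the nonlocal normal derivative is $\mathcal{N}_s w(x)=C_{N,s}\int_\Omega\frac{w(x)-w(y)}{|x-y|^{N+2s}}\,dy$ for $x\in\mathbb{R}^N\setminus\overline\Omega$. Spaces: set $$\mathcal{F}_R(\rho,\psi)=\frac{C_{N,s}}{2}\iint_{\mathbb{R}^{2N}\setminus(\mathbb{R}^N\setminus\Omega)^2}\frac{(\rho(x)-\rho(y))(\psi(x)-\psi(y))}{|x-y|^{N+2s}}\,dx\,dy,$$ and let $\mathbb{H}^s_\Omega$ be the Hilbert space of measurable $\rho:\mathbb{R}^N\to\mathbb{R}$ with finite norm $\|\rho\|_{\mathbb{H}^s_\Omega}=\big(\|\rho\|^2_{L^2(\mathbb{R}^N)}+\mathcal{F}_R(\rho,\rho)\big)^{1/2}$. Its dual is $(\mathbb{H}^s_\Omega)^\star$, with $L^2(\Omega)$ as pivot space: $\mathbb{H}^s_\Omega\hookrightarrow L^2(\Omega)\hookrightarrow(\mathbb{H}^s_\Omega)^\star$, where elements of $\mathbb{H}^s_\Omega$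 are restricted to $\Omega$ and $u\in L^2(\Omega)$ is identified with the functional $\psi\mapsto\int_\Omega u\psi\,dx$. Time derivatives are taken in this sense. $W(0,T;\mathbb{H}^s_\Omega)=\{\zeta\in L^2(0,T;\mathbb{H}^s_\Omega):\zeta_t\in L^2(0,T;(\mathbb{H}^s_\Omega)^\star)\}$ embeds continuously in $C([0,T];L^2(\Omega))$, so values at fixed times make sense in $L^2(\Omega)$. Let $H(Q)=\{\xi\in W(0,T;\mathbb{H}^s_\Omega):\xi(\cdot,T)=0\text{ a.e. in }\Omega\}$. Weak solution: for $f\in L^2(Q)$, $g\in L^2(\Sigma)$, $\rho_0\in L^2(\Omega)$, the weak solution is the unique $\rho\in W(0,T;\mathbb{H}^s_\Omega)$ such that for all $\phi\in H(Q)$, $$-\int_0^T\langle\phi_t,\rho\rangle_{(\mathbb{H}^s_\Omega)^\star,\mathbb{H}^s_\Omega}dt+\int_0^T\mathcal{F}_R(\rho,\phi)\,dt+\int_\Sigma\rho\phi\,dx\,dt=\int_Q f\phi\,dx\,dt+\int_\Sigma g\phi\,dx\,dt+\int_\Omega\rho_0\,\phi(\cdot,0)\,dx.$$ *)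

(* Defs.v *)
From HB Require Import structures.
From mathcomp Require Import all_boot all_order all_algebra.
From mathcomp Require Import all_classical all_reals all_analysis.
From mathcomp Require Import measurable_realfun.

Set Implicit Arguments.
Unset Strict Implicit.
Unset Printing Implicit Defensive.
Import Order.TTheory GRing.Theory Num.Theory.
Import numFieldNormedType.Exports.
Local Open Scope classical_set_scope.
Local Open Scope ring_scope.

(* 'rV[R]_n carries its Borel sigma-algebra, generated by the open sets of the
   library's (product) topology. *)
Section rV_borel.
Variables (R : realType) (n : nat).

HB.instance Definition _ :=
  @isMeasurable.Build (sigma_display (@open 'rV[R]_n)) 'rV[R]_n
  <<s @open 'rV[R]_n >> (@sigma_algebra0 _ setT _) (@sigma_algebraC _ _)
  (@sigma_algebra_bigcup _ setT _).

Lemma open_measurable_rV (U : set 'rV[R]_n) : open U -> measurable U.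
Proof. exact: sub_sigma_algebra. Qed.

Lemma measurable_fun_rV d (T : measurableType d) (f : T -> 'rV[R]_n) :
  (forall i, measurable_fun [set: T] (fun x => f x 0 i)) ->
  measurable_fun [set: T] f.
Proof.
move=> mf.
apply: (@measurability _ _ _ _ setT f (@open 'rV[R]_n)) => //.
move=> _ [U oU <-]; rewrite setTI.
pose box (p : {ffun 'I_n -> rat} * nat) : set 'rV[R]_n :=
  [set y | forall i, `|y 0 i - ratr (p.1 i)| < p.2.+1%:R^-1].
have -> : U = \bigcup_(p in [set p | box p `<=` U]) box p.
  apply/seteqP; split=> [x Ux|x [p pU]]; last exact: pU.
  have /nbhs_ballP[e /= e0 eU] : nbhs x U by exact: open_nbhs_nbhs.
  have e20 : 0 < e / 2 by rewrite divr_gt0.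
  have [k ke] : exists k : nat, k.+1%:R^-1 < e / 2.
    exists (Num.truncn (e / 2)^-1).
    by rewrite invf_plt ?posrE//; exact: truncnS_gt.
  have k0 : (0 : R) < k.+1%:R^-1 by rewrite invr_gt0.
  have /choice[q qP] i :
      exists q : rat, `|x 0 i - ratr q| < k.+1%:R^-1.
    have /rat_in_itvoo[q] : x 0 i - k.+1%:R^-1 < x 0 i + k.+1%:R^-1.
      by rewrite ltrD2l (lt_trans _ k0) // oppr_lt0.
    by rewrite in_itv/= -ltr_distlC => qP; exists q.
  exists ([ffun i => q i], k); last by move=> i /=; rewrite ffunE.
  move=> /= y by_; apply: eU; split=> //= a i.
  rewrite (ord1 a) /ball/= (le_lt_trans (ler_distD (ratr (q i)) _ _))//.
  rewrite [e]splitr ltrD// (lt_trans _ ke)//.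
  by rewrite distrC; have := by_ i; rewrite /= ffunE.
rewrite preimage_bigcup bigcup_mkcond.
apply: countable_bigcupT_measurable => [|p]; first exact: countableP.
case: ifP => // _.
have -> : f @^-1` box p = \bigcap_(i in [set: 'I_n])
    ((fun x => f x 0 i) @^-1` ball (ratr (p.1 i) : R) p.2.+1%:R^-1).
  apply/seteqP; split => [x bx i _|x bx i] /=.
    by rewrite /ball/= distrC; exact: bx.
  by rewrite distrC; exact: (bx i).
apply: fin_bigcap_measurable => // i _.
rewrite -[X in measurable X]setTI; apply: mf => //.
exact: (open_measurable (ball_open _ _)).
Qed.

Lemma measurable_coord (i : 'I_n) :
  measurable_fun [set: 'rV[R]_n] (fun x => x 0 i).
Proof.
apply: (measurability _ (RGenOpens.measurableE R)).
move=> _ [_ [a [b ->] <-]]; rewrite setTI; apply: open_measurable_rV.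
apply: open_comp; last exact: interval_open.
by move=> x _; exact: coord_continuous.
Qed.

End rV_borel.

(* n-dimensional Lebesgue measure, by recursion on n: the image of the product
   of the one-dimensional measure and the n-dimensional one under
   R * R^n ~ R^(n+1). *)
Section lebesgue_rV.
Context (R : realType).

Definition cons_rV n (p : R * 'rV[R]_n) : 'rV[R]_n.+1 :=
  row_mx (const_mx p.1 : 'rV_1) p.2.

Definition uncons_rV n (v : 'rV[R]_n.+1) : R * 'rV[R]_n :=
  ((v : 'rV_(1 + n)) 0 (lshift n 0), rsubmx (v : 'rV_(1 + n))).

Lemma cons_rVK n : cancel (@cons_rV n) (@uncons_rV n).
Proof.
by move=> [a v]; rewrite /uncons_rV /cons_rV row_mxKr row_mxEl mxE.
Qed.

Lemma measurable_cons_rV n : measurable_fun setT (@cons_rV n).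
Proof.
apply: measurable_fun_rV => i; rewrite -(@splitK 1 n i).
case: (@fintype.split 1 n i) => j /=.
  rewrite [X in measurable_fun _ X](_ : _ = fst); first exact: measurable_fst.
  by apply/funext => p; rewrite [LHS](@row_mxEl _ 1 1 n) mxE.
rewrite [X in measurable_fun _ X](_ : _ = (fun x : 'rV[R]_n => x 0 j) \o snd).
  by apply: measurableT_comp; [exact: measurable_coord|exact: measurable_snd].
by apply/funext => p; exact: (@row_mxEr _ 1 1 n).
Qed.

Lemma measurable_uncons_rV n : measurable_fun setT (@uncons_rV n).
Proof.
apply: measurable_fun_pair; first exact: (@measurable_coord R n.+1).
apply: measurable_fun_rV => i.
rewrite [X in measurable_fun _ X](_ : _ =
  (fun x : 'rV_n.+1 => x 0 (rshift 1 i))).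
  exact: (@measurable_coord R n.+1).
by apply/funext => v; rewrite !mxE.
Qed.

Section lebesgue_rV_step.
Variables (n : nat) (mu : {sigma_finite_measure set 'rV[R]_n -> \bar R}).

Definition lebesgue_rV_step : set 'rV[R]_n.+1 -> \bar R :=
  pushforward (lebesgue_measure \x mu)%E (@cons_rV n).

Let step0 : lebesgue_rV_step set0 = 0%E.
Proof. by rewrite /lebesgue_rV_step /pushforward preimage_set0 measure0. Qed.

Let step_ge0 A : (0 <= lebesgue_rV_step A)%E.
Proof. by rewrite /lebesgue_rV_step /pushforward measure_ge0. Qed.

Let step_sigma_additive : semi_sigma_additive lebesgue_rV_step.
Proof.
exact: (@measure_semi_sigma_additive _ _ _
  (measure_function_pushforward__canonical__measure_function_Measure
     (lebesgue_measure \x mu)%E (@measurable_cons_rV n))).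
Qed.

HB.instance Definition _ := isMeasure.Build _ _ _ lebesgue_rV_step
  step0 step_ge0 step_sigma_additive.

Let step_sigma_finite : sigma_finite setT lebesgue_rV_step.
Proof.
have /sigma_finiteP[F [TF ndF Foo]] := sigma_finiteT (@lebesgue_measure R).
have /sigma_finiteP[G [TG ndG Goo]] := sigma_finiteT mu.
exists (fun k => @uncons_rV n @^-1` (F k `*` G k)).
  rewrite -preimage_bigcup -[LHS](@preimage_setT _ _ (@uncons_rV n)).
  congr (_ @^-1` _); rewrite -setXTT TF TG; apply/seteqP; split=> -[x y] /=.
    move=> [[k _ Fkx] [l _ Gly]]; exists (maxn k l) => //; split.
    - by move: x Fkx; exact/subsetPset/ndF/leq_maxl.
    - by move: y Gly; exact/subsetPset/ndG/leq_maxr.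
  by move=> [k _ []/= ? ?]; split; exists k.
move=> k; have [mF Fk] := Foo k; have [mG Gk] := Goo k; split.
  rewrite -[X in measurable X]setTI; apply: measurable_uncons_rV => //.
  exact: measurableX.
rewrite /lebesgue_rV_step /pushforward -comp_preimage.
rewrite (_ : _ \o _ = id); last by apply/funext => p /=; rewrite cons_rVK.
rewrite preimage_id product_measure1E// lte_mul_pinfty//.
by rewrite ge0_fin_numE.
Qed.

HB.instance Definition _ := Measure_isSigmaFinite.Build _ _ _ lebesgue_rV_step
  step_sigma_finite.

End lebesgue_rV_step.

Fixpoint lebesgue_rV (n : nat) :
    {sigma_finite_measure set 'rV[R]_n -> \bar R} :=
  if n is m.+1 then lebesgue_rV_step (lebesgue_rV m) else \d_(0 : 'rV[R]_0).

End lebesgue_rV.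

Section euclidean.
Context (R : realType) (N : nat).
Implicit Types (x y : 'rV[R]_N) (Omega : set 'rV[R]_N).

Definition dotv x y : R := \sum_i x 0 i * y 0 i.

(* The library norm of 'rV[R]_N is the sup norm. *)
Definition enorm x : R := Num.sqrt (dotv x x).

(* Near each boundary point, Omega is the strict epigraph, in some direction
   given by a unit vector e, of a Lipschitz function gamma defined on the
   hyperplane orthogonal to e (so y - <y, e> e is the projection of y). *)
Definition lipschitz_boundary Omega : Prop :=
  forall z, (closure Omega `\` Omega°) z ->
  exists (e : 'rV[R]_N) (gamma : 'rV[R]_N -> R),
    [/\ dotv e e = 1,
        [lipschitz gamma y | y in [set y | dotv y e = 0]] &
        \forall y \near z, Omega y <-> gamma (y - dotv y e *: e) < dotv y e].

Definition bounded_lipschitz_domain Omega : Prop :=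
  [/\ open Omega, connected Omega, Omega !=set0, bounded_set Omega &
      lipschitz_boundary Omega].

End euclidean.

Section square_integrable.
Local Open Scope ereal_scope.

Definition square_integrable d (X : measurableType d) (R : realType)
    (mu : {measure set X -> \bar R}) (D : set X) (f : X -> R) : Prop :=
  measurable_fun D f /\ \int[mu]_(x in D) (f x ^+ 2)%:E < +oo.

End square_integrable.

Section bochner.
Context (R : realType) (V : zmodType).
Local Notation leb := (@lebesgue_measure R).

Definition simple_map (X : set V) (u : R -> V) : Prop :=
  [/\ forall t, X (u t), finite_set (range u) &
      forall v, measurable (u @^-1` [set v])].

(* The Bochner space L^2(I; X), for X a linear subspace of V normed by nrm. *)
Definition bochner_L2 (I : set R) (X : set V) (nrm : V -> \bar R)
    (u : R -> V) : Prop :=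
  [/\ {ae leb, forall t, I t -> X (u t)},
      exists2 a : nat -> R -> V, forall n, simple_map X (a n) &
        {ae leb, forall t, I t -> nrm (a n t - u t) @[n --> \oo] --> 0%E} &
      (\int[leb]_(t in I) (nrm (u t) ^+ 2) < +oo)%E].

End bochner.

Section fractional.
Context (R : realType) (N : nat) (Omega : set 'rV[R]_N) (s T : R).

Local Notation Rn := 'rV[R]_N.
Local Notation leb := (@lebesgue_measure R).
Local Notation lebx := (lebesgue_rV R N).
Local Notation lebxt := (lebx \x leb)%E.

Definition Gamma (a : R) : R :=
  \int[leb]_(t in `]0, +oo[) (t `^ (a - 1) * expR (- t)).

Definition C_Ns : R :=
  s * 2 `^ (2 * s) * Gamma ((2 * s + N%:R) / 2) /
  (pi `^ (N%:R / 2) * Gamma (1 - s)).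

Section spaces.
Local Open Scope ereal_scope.

(* Takes values in \bar R since F_R psi psi may be +oo; the integrand is 0 on
   the (negligible) diagonal, the library's inverse of 0 being 0. *)
Definition F_R (rho psi : Rn -> R) : \bar R :=
  (C_Ns / 2)%:E *
  \int[lebx \x lebx]_(z in ~` (~` Omega `*` ~` Omega))
     ((rho z.1 - rho z.2) * (psi z.1 - psi z.2) /
      enorm (z.1 - z.2) `^ (N%:R + 2 * s))%:E.

Definition Hs_norm (rho : Rn -> R) : \bar R :=
  sqrte ((\int[lebx]_x (rho x ^+ 2)%:E) + F_R rho rho).

Definition Hs : set (Rn -> R) :=
  [set rho | measurable_fun setT rho /\ Hs_norm rho < +oo].

Definition Hs_dual_norm (L : (Rn -> R) -> R) : \bar R :=
  ereal_sup [set `|L psi|%:E | psi in [set psi | Hs psi /\ Hs_norm psi <= 1]].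

(* A functional is only constrained on Hs; its finite dual norm makes it
   invariant under modification of its argument on a negligible set. *)
Definition Hs_dual : set ((Rn -> R) -> R) :=
  [set L | (forall (a : R) (u v : Rn -> R), Hs u -> Hs v ->
              L (fun x => a * u x + v x)%R = (a * L u + L v)%R) /\
           Hs_dual_norm L < +oo].

End spaces.

Local Notation I := (`]0, T[%classic : set R).

Definition cylQ : set (Rn * R) := Omega `*` I.
Definition cylSigma : set (Rn * R) := ~` Omega `*` I.

Definition slice (zeta : Rn * R -> R) (t : R) : Rn -> R := fun x => zeta (x, t).

(* An element of L^2(0,T;Hs) is given by a jointly measurable representative,
   so that it is also a function on R^N x (0,T). *)
Definition L2_Hs (zeta : Rn * R -> R) : Prop :=
  measurable_fun (setT `*` I) zeta /\ bochner_L2 I Hs Hs_norm (slice zeta).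

Definition L2_Hs_dual (L : R -> (Rn -> R) -> R) : Prop :=
  bochner_L2 I Hs_dual Hs_dual_norm L.

(* C_c^oo(0,T) *)
Definition test_function (theta : R -> R) : Prop :=
  (forall n t, derivable (derive1n n theta) t 1) /\
  exists a b, [/\ 0 < a, b < T & forall t, ~~ (a <= t <= b) -> theta t = 0].

(* zeta_t = L in L^2(0,T;Hs^* ): the distributional derivative on (0,T) of
   zeta, seen in Hs^* through the pivot space L^2(Omega); the identity in Hs^*
   is tested against psi in Hs. *)
Definition time_derivative (zeta : Rn * R -> R) (L : R -> (Rn -> R) -> R) :
    Prop :=
  L2_Hs_dual L /\
  forall theta psi, test_function theta -> Hs psi ->
    \int[leb]_(t in I) (theta t * L t psi) =
    - (\int[leb]_(t in I)
         (derive1 theta t * \int[lebx]_(x in Omega) (zeta (x, t) * psi x))).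

Definition W (zeta : Rn * R -> R) : Prop :=
  L2_Hs zeta /\ exists L, time_derivative zeta L.

Definition continuous_L2 (v : R -> Rn -> R) : Prop :=
  forall t, t \in `[0, T] ->
    square_integrable lebx Omega (v t) /\
    (\int[lebx]_(x in Omega) ((v r x - v t x) ^+ 2)%:E)%E
      @[r --> within `[0, T]%classic (nbhs t)] --> 0%E.

(* zeta(., t0) = w in L^2(Omega), where zeta(., t0) is the value at t0 of the
   representative of zeta in C([0,T];L^2(Omega)). *)
Definition time_value (zeta : Rn * R -> R) (t0 : R) (w : Rn -> R) : Prop :=
  square_integrable lebx Omega w /\
  exists v : R -> Rn -> R,
    [/\ continuous_L2 v,
        {ae leb, forall t, I t ->
           {ae lebx, forall x, Omega x -> v t x = zeta (x, t)}} &
        {ae lebx, forall x, Omega x -> v t0 x = w x}].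

Definition HQ (xi : Rn * R -> R) : Prop := W xi /\ time_value xi T (cst 0).

Definition weak_solution (f g : Rn * R -> R) (rho0 : Rn -> R)
    (rho : Rn * R -> R) : Prop :=
  W rho /\
  forall (phi : Rn * R -> R) (dphi : R -> (Rn -> R) -> R) (phi0 : Rn -> R),
    HQ phi -> time_derivative phi dphi -> time_value phi 0 phi0 ->
    - (\int[leb]_(t in I) dphi t (slice rho t))
    + (\int[leb]_(t in I) fine (F_R (slice rho t) (slice phi t)))
    + (\int[lebxt]_(z in cylSigma) (rho z * phi z))
    = (\int[lebxt]_(z in cylQ) (f z * phi z))
    + (\int[lebxt]_(z in cylSigma) (g z * phi z))
    + (\int[lebx]_(x in Omega) (rho0 x * phi0 x)).

Definition L2_data (f g : Rn * R -> R) (rho0 : Rn -> R) : Prop :=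
  [/\ square_integrable lebxt cylQ f, square_integrable lebxt cylSigma g &
      square_integrable lebx Omega rho0].

End fractional.

(* Main.v *)
From HB Require Import structures.
Require Import Defs.
From mathcomp Require Import all_boot all_order all_algebra.
From mathcomp Require Import all_classical all_reals all_analysis.
From mathcomp Require Import measurable_realfun ring lra.

(** Let u be the difference of the two solutions, extended by 0 outside the time
    interval, and let B(v, w) be F_R(v, w) plus the integral of v w over the
    complement of Omega.  Formally one tests the equation of u with its positive
    part u^+: the time derivative gives half the derivative of the squared
    L^2(Omega) norm of u^+, the bilinear term satisfies B(u, u^+) >= B(u^+, u^+),
    and the data contribute a nonpositive amount, so that u^+ vanishes.

    This is made rigorous without a chain rule for u^+, by moving the time
    regularity onto averages v(t) of u over the window [t - h, t[, for a fixed h.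
    The weak form is only tested with products theta(t) psi(x), where theta is
    piecewise linear and psi is in Hs ([product_test_HQ],
    [weak_solution_weak_form]).  For theta take the trapezoid whose derivative is
    minus the window of length h ending at t plus the one ending at t - D; then
    the time term is the integral over Omega of (v(t) - v(t - D)) psi, and for
    psi = v(t)^+ convexity makes this an implicit Euler step for the squared norm
    of v^+.  In the bilinear term the trapezoid differs from D times the window by
    at most D, and only on two windows of length D, so that replacing one by the
    other costs at most D times the energy that u spends there, plus D^2 times the
    energy of psi ([pairing_trapezoid_ge]); the latter is absorbed by the main term
    D B(psi, psi) when D <= 1.  The result is [energy_step].

    Summing the steps over a grid of mesh D = t / k, the errors telescope to
    D times the total energy of u ([inner_mass_grid]); as k grows this forces
    v(t) <= 0 a.e. in Omega, for every t and h.  In a single step the time term is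
    then gone; dividing by D and letting D tend to 0 shows that v(t)^+ also
    vanishes outside Omega, where B controls its L^2 norm ([boundary_mass_le0]).
    Hence for a.e. x the function u(x, .) has nonpositive integral over every
    interval with rational endpoints, and Lebesgue differentiation gives u <= 0
    ([ae_le0_of_windows]).

    The second assertion compares the solution with the function 0, which satisfies
    the weak form for zero data.

    Throughout, both terms of B are treated as L^2 inner products, by writing
    F_R(v, w) as the inner product of weighted differences ([frac_diff]) on
    R^N x R^N. *)

Set Implicit Arguments.
Unset Strict Implicit.
Unset Printing Implicit Defensive.
Import Order.TTheory GRing.Theory Num.Theory.
Import numFieldNormedType.Exports.
Import HBSimple HBNNSimple.
Local Open Scope classical_set_scope.
Local Open Scope ring_scope.

(** * Square-integrable functions and iterated integrals *)

Section L2.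
Context d (X : measurableType d) (R : realType).
Implicit Types (m : {measure set X -> \bar R}) (f g : X -> R).

Lemma square_integrable_patch m (D : set X) f : measurable D ->
  square_integrable m D f -> square_integrable m setT (f \_ D).
Proof.
move=> mD [mf f2]; split; first exact/(measurable_restrictT _ mD).1.
rewrite (_ : (fun x => _) = (fun x => (f x ^+ 2)%:E) \_ D) -?integral_mkcond//.
by apply/funext => x; rewrite /patch; case: ifP => //; rewrite expr0n.
Qed.

Lemma square_integrableS m (D E : set X) f : measurable D -> measurable E ->
  E `<=` D -> square_integrable m D f -> square_integrable m E f.
Proof.
move=> mD mE ED [mf f2]; split; first exact: measurable_funS mf.
apply: le_lt_trans f2; apply: ge0_subset_integral => //.
- exact/measurable_EFinP/measurable_funX.
- by move=> x _; rewrite lee_fin sqr_ge0.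
Qed.

Lemma integrable_sqr m f : square_integrable m setT f ->
  m.-integrable setT (fun x => (f x ^+ 2)%:E).
Proof.
move=> [mf f2]; apply/integrableP; split.
  exact/measurable_EFinP/measurable_funX.
by under eq_integral do rewrite gee0_abs ?lee_fin ?sqr_ge0//.
Qed.

Lemma square_integrable_le m f g : measurable_fun setT f ->
  (forall x, `|f x| <= `|g x|) ->
  square_integrable m setT g -> square_integrable m setT f.
Proof.
move=> mf fg [mg g2]; split=> //; apply: le_lt_trans g2.
apply: ge0_le_integral => //.
- by move=> x _; rewrite lee_fin sqr_ge0.
- exact/measurable_EFinP/measurable_funX.
- exact/measurable_EFinP/measurable_funX.
- move=> x _; rewrite lee_fin -real_normK ?num_real// -[leRHS]real_normK ?num_real//.
  by rewrite lerXn2r ?nnegrE.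
Qed.

Lemma square_integrableZ m (c : R) f :
  square_integrable m setT f -> square_integrable m setT (fun x => c * f x).
Proof.
move=> sf; have [mf _] := sf; split; first exact: measurable_funM.
rewrite (eq_integral (fun x => (c ^+ 2)%:E * (f x ^+ 2)%:E)%E).
  rewrite integralZl//; last exact: integrable_sqr.
  by rewrite lte_mul_pinfty ?lee_fin ?sqr_ge0//; case: sf.
by move=> x _; rewrite exprMn.
Qed.

Lemma square_integrableD m f g : square_integrable m setT f ->
  square_integrable m setT g -> square_integrable m setT (fun x => f x + g x).
Proof.
move=> sf sg; have [mf f2] := sf; have [mg g2] := sg.
split; first exact: measurable_funD.
have i2 := integrableZl measurableT 2
  (integrableD measurableT (integrable_sqr sf) (integrable_sqr sg)).
apply: le_lt_trans (integrable_lty measurableT i2).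
apply: ge0_le_integral => //=.
- by move=> x _; rewrite lee_fin sqr_ge0.
- exact/measurable_EFinP/measurable_funX/measurable_funD.
- exact: measurable_int i2.
- by move=> x _; rewrite lee_fin; have := sqr_ge0 (f x - g x); nra.
Qed.

Lemma square_integrableB m f g : square_integrable m setT f ->
  square_integrable m setT g -> square_integrable m setT (fun x => f x - g x).
Proof.
move=> sf /(square_integrableZ (-1)) /(square_integrableD sf).
by under eq_fun do rewrite mulN1r.
Qed.

Lemma integrable_mul m f g : square_integrable m setT f ->
  square_integrable m setT g -> m.-integrable setT (fun x => (f x * g x)%:E).
Proof.
move=> sf sg; have [mf f2] := sf; have [mg g2] := sg.
apply: le_integrable (integrableD measurableT (integrable_sqr sf)
  (integrable_sqr sg)) => //=.
  exact/measurable_EFinP/measurable_funM.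
move=> x _; rewrite lee_fin [leRHS]ger0_norm ?addr_ge0 ?sqr_ge0// normrM.
rewrite -[f x ^+ 2]real_normK ?num_real// -[g x ^+ 2]real_normK ?num_real//.
have := sqr_ge0 (`|f x| - `|g x|); have := normr_ge0 (f x).
by have := normr_ge0 (g x); nra.
Qed.

Lemma Rintegral_ae_eq m f g : measurable_fun setT f -> measurable_fun setT g ->
  {ae m, forall x, f x = g x} -> \int[m]_x f x = \int[m]_x g x.
Proof.
move=> mf mg fg; congr fine; apply: ae_eq_integral => //.
- exact/measurable_EFinP.
- exact/measurable_EFinP.
- by apply: filterS fg => x /= ->.
Qed.

Lemma ae_le_Rintegral m f g : m.-integrable setT (EFin \o f) ->
  m.-integrable setT (EFin \o g) -> {ae m, forall x, f x <= g x} ->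
  \int[m]_x f x <= \int[m]_x g x.
Proof.
move=> jf jg fg; rewrite -subr_ge0 -RintegralB//.
have mgf : measurable_fun setT (fun x => g x - f x).
  by apply: measurable_funB; apply/measurable_EFinP;
    [exact: measurable_int jg|exact: measurable_int jf].
rewrite (@Rintegral_ae_eq m _ (fun x => `|g x - f x|))//.
- exact: Rintegral_ge0.
- exact: measurableT_comp.
- by apply: filterS fg => x fgx; rewrite ger0_norm// subr_ge0.
Qed.

Lemma square_integrable_ae m f g : measurable_fun setT f ->
  {ae m, forall x, f x = g x} ->
  square_integrable m setT g -> square_integrable m setT f.
Proof.
move=> mf fg [mg g2]; split=> //.
rewrite (@ae_eq_integral _ _ _ m setT (fun x => (g x ^+ 2)%:E))//.
- exact/measurable_EFinP/measurable_funX.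
- exact/measurable_EFinP/measurable_funX.
- by apply: filterS fg => x /= ->.
Qed.

(** This is how a vanishing energy is turned into a pointwise statement. *)
Lemma Rintegral_sqr_eq0 m f : square_integrable m setT f ->
  \int[m]_x (f x ^+ 2) <= 0 -> {ae m, forall x, f x = 0}.
Proof.
move=> sf f0; have [mf _] := sf.
have if2 := integrable_sqr sf.
have h : (\int[m]_x `|(f x ^+ 2)%:E| = 0)%E.
  under eq_integral do rewrite gee0_abs ?lee_fin ?sqr_ge0//.
  rewrite -[LHS]fineK; last exact: integrable_fin_num.
  congr EFin; apply/eqP; rewrite eq_le f0/=.
  by apply: Rintegral_ge0 => x _; exact: sqr_ge0.
have := (ae_eq_integral_abs m measurableT _).1 h.
move=> /(_ (measurable_int _ if2)); apply: filterS => x /(_ Logic.I)/= [] /eqP.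
by rewrite sqrf_eq0 => /eqP.
Qed.

(** Even if the positive and the negative part both diverge, the two sides are the
    same extended number.  Thanks to this F_R can be evaluated at every time, and
    not only at almost every time. *)
Lemma ge0_integralZl_measurable m (D : set X) (f : X -> \bar R) (c : R) :
  measurable D -> measurable_fun D f -> 0 <= c ->
  (\int[m]_(x in D) (c%:E * f x) = c%:E * \int[m]_(x in D) f x)%E.
Proof.
move=> mD mf; rewrite le_eqVlt => /predU1P[<-|c0].
  by rewrite mul0e integral0_eq// => x _; rewrite mul0e.
rewrite integralE [in RHS]integralE (ge0_funeposM _ (ltW c0)) (ge0_funenegM _ (ltW c0)).
rewrite !ge0_integralZl_EFin ?(ltW c0)//; [|exact: measurable_funeneg|exact: measurable_funepos].
have := integral_ge0 m (fun x (_ : D x) => funepos_ge0 f x).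
have := integral_ge0 m (fun x (_ : D x) => funeneg_ge0 f x).
case: (\int[m]_(x in D) f^\- x)%E => [b| |]//; case: (\int[m]_(x in D) f^\+ x)%E => [a| |]//= _ _.
- by rewrite -EFinM -!EFinD -EFinM mulrBr.
- by rewrite gt0_muley ?lte_fin// !addye// gt0_muley ?lte_fin.
- by rewrite gt0_muley ?lte_fin// addeNy gt0_muleNy ?lte_fin.
- by rewrite gt0_muley ?lte_fin// addeNy gt0_muleNy ?lte_fin.
Qed.

End L2.

Section prod_measure.
Context d d' (X : measurableType d) (Y : measurableType d') (R : realType).
Variables (m1 : {sigma_finite_measure set X -> \bar R})
  (m2 : {sigma_finite_measure set Y -> \bar R}).

(** An alias of the product measure which carries its sigma-finiteness, so that
    R^N x R^N can in turn be multiplied by the time line. *)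
Definition sigma_finite_prod : set (X * Y)%type -> \bar R := (m1 \x m2)%E.

HB.instance Definition _ := Measure.on sigma_finite_prod.

Let sfin : sigma_finite setT sigma_finite_prod.
Proof.
have /sigma_finiteP[F [TF ndF Foo]] := sigma_finiteT m1.
have /sigma_finiteP[G [TG ndG Goo]] := sigma_finiteT m2.
exists (fun n => F n `*` G n).
  apply/seteqP; split=> // -[x y] _.
  have [i _ Fi] : (\bigcup_i F i) x by rewrite -TF.
  have [j _ Gj] : (\bigcup_j G j) y by rewrite -TG.
  exists (maxn i j) => //; split.
  - by have /subsetPset := ndF _ _ (leq_maxl i j); exact.
  - by have /subsetPset := ndG _ _ (leq_maxr i j); exact.
move=> n; have [mF Fn] := Foo n; have [mG Gn] := Goo n.
split; first exact: measurableX.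
by rewrite [X in (X < _)%E]product_measure1E// lte_mul_pinfty ?ge0_fin_numE.
Qed.

HB.instance Definition _ :=
  Measure_isSigmaFinite.Build _ _ _ sigma_finite_prod sfin.

Lemma Rintegral_fubini1 (f : (X * Y)%type -> R) :
  (m1 \x m2)%E.-integrable setT (EFin \o f) ->
  \int[(m1 \x m2)%E]_z f z = \int[m1]_x \int[m2]_y f (x, y).
Proof.
move=> intf; rewrite /Rintegral -(integral12_prod_meas1 intf); congr fine.
have mF := measurable_fubini_F intf.
apply: ae_eq_integral => //.
  by apply/measurable_EFinP; apply: measurableT_comp mF; exact: fine_measurable.
apply: filterS (ae_integrable1 intf) => x /(integrable_fin_num measurableT) fx _.
by rewrite /= fineK.
Qed.

Lemma Rintegral_fubini2 (f : (X * Y)%type -> R) :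
  (m1 \x m2)%E.-integrable setT (EFin \o f) ->
  \int[(m1 \x m2)%E]_z f z = \int[m2]_y \int[m1]_x f (x, y).
Proof.
move=> intf; rewrite /Rintegral -(integral21_prod_meas1 intf); congr fine.
have mF := measurable_fubini_G intf.
apply: ae_eq_integral => //.
  by apply/measurable_EFinP; apply: measurableT_comp mF; exact: fine_measurable.
apply: filterS (ae_integrable2 intf) => x /(integrable_fin_num measurableT) fx _.
by rewrite /= fineK.
Qed.

(** The function may fail to be integrable on some sections; its integral there
    is a conventional value, and measurability holds all the same because the
    positive and negative parts are integrated separately. *)
Lemma measurable_fun_Rintegral (f : (X * Y)%type -> R) :
  measurable_fun setT f -> measurable_fun setT (fun x => \int[m2]_y f (x, y)).
Proof.
move=> mf; apply: measurableT_comp; first exact: fine_measurable.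
have mEf : measurable_fun setT (EFin \o f) by exact/measurable_EFinP.
rewrite (_ : (fun x => _) = fubini_F m2 (EFin \o f)^\+%E \-
    fubini_F m2 (EFin \o f)^\-%E)%E; last first.
  apply/funext => x; rewrite [LHS]integralE; congr (_ - _)%E.
  - by rewrite /fubini_F; apply: eq_integral => y _; rewrite !(funeposE,funenegE).
  - by rewrite /fubini_F; apply: eq_integral => y _; rewrite !(funeposE,funenegE).
apply: emeasurable_funB; apply: measurable_fun_fubini_tonelli_F => //.
- exact: measurable_funepos.
- exact: measurable_funeneg.
Qed.

Lemma square_integrable_tensor (f : X -> R) (g : Y -> R) :
  square_integrable m1 setT f -> square_integrable m2 setT g ->
  square_integrable (m1 \x m2)%E setT (fun z => f z.1 * g z.2).
Proof.
move=> sf sg; have [mf f2] := sf; have [mg g2] := sg.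
have mfg : measurable_fun setT (fun z : (X * Y)%type => f z.1 * g z.2).
  by apply: measurable_funM; [exact: (measurableT_comp mf)|exact: (measurableT_comp mg)].
split=> //; rewrite fubini_tonelli1 => [|/=|z].
- rewrite (eq_integral (fun x => (f x ^+ 2)%:E * \int[m2]_y (g y ^+ 2)%:E)%E).
    rewrite ge0_integralZr//.
    + have h0 : (0 <= \int[m1]_x (f x ^+ 2)%:E)%E.
        by apply: integral_ge0 => x _; rewrite lee_fin sqr_ge0.
      by rewrite lte_mul_pinfty// ge0_fin_numE.
    + exact/measurable_EFinP/measurable_funX.
    + by move=> x _; rewrite lee_fin sqr_ge0.
    + by apply: integral_ge0 => y _; rewrite lee_fin sqr_ge0.
  move=> x _; rewrite /fubini_F -integralZl//=; last exact: integrable_sqr.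
  by apply: eq_integral => y _; rewrite exprMn.
- exact/measurable_EFinP/measurable_funX.
- by rewrite lee_fin sqr_ge0.
Qed.

End prod_measure.

Section cauchy_schwarz.
Context d (X : measurableType d) (R : realType) (m : {measure set X -> \bar R}).

(** The nonnegative integral of (f - (a / k) g)^2, where a is the integral of g f,
    is at most that of f^2 minus a^2 / k.  With an infinite integral of f^2 the
    bound is trivial, because k is positive. *)
Lemma cauchy_schwarz_bound (k : R) (f g : X -> R) : 0 < k ->
  measurable_fun setT f ->
  square_integrable m setT g -> (\int[m]_x (g x ^+ 2)%:E <= k%:E)%E ->
  (((\int[m]_x (g x * f x)) ^+ 2)%:E <= k%:E * \int[m]_x (f x ^+ 2)%:E)%E.
Proof.
move=> k0 mf sg gk; have [f2|] := ltP (\int[m]_x (f x ^+ 2)%:E)%E +oo%E; last first.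
  by rewrite leye_eq => /eqP ->; rewrite gt0_muley ?leey.
have sf : square_integrable m setT f by [].
set a := \int[m]_x (g x * f x).
have h : 0 <= \int[m]_x ((f x - (a / k) * g x) ^+ 2).
  by apply: Rintegral_ge0 => x _; exact: sqr_ge0.
have if2 := integrable_sqr sf; have ig2 := integrable_sqr sg.
have ifg := integrable_mul sg sf.
have e : \int[m]_x ((f x - (a / k) * g x) ^+ 2) =
    \int[m]_x (f x ^+ 2) - (2 * (a / k)) * a + (a / k) ^+ 2 * \int[m]_x (g x ^+ 2).
  under eq_Rintegral.
    move=> x _; rewrite (_ : _ ^+ 2 =
      f x ^+ 2 - (2 * (a / k)) * (g x * f x) + (a / k) ^+ 2 * (g x ^+ 2)); last by ring.
    over.
  have i1 := integrableZl measurableT (2 * (a / k)) ifg.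
  have i3 := integrableZl measurableT ((a / k) ^+ 2) ig2.
  rewrite RintegralD//=; last exact: integrableB if2 i1.
  rewrite RintegralB//=.
  by rewrite !RintegralZl.
rewrite -[X in (_ <= _ * X)%E]fineK; last first.
  by rewrite ge0_fin_numE// integral_ge0// => x _; rewrite lee_fin sqr_ge0.
rewrite -EFinM lee_fin -/(Rintegral m setT (fun x => f x ^+ 2)).
set F := \int[m]_x (f x ^+ 2) in e *.
set G := \int[m]_x (g x ^+ 2) in e *.
have Gk : G <= k.
  rewrite -lee_fin fineK// ge0_fin_numE; first exact: le_lt_trans gk (ltry _).
  by rewrite integral_ge0// => x _; rewrite lee_fin sqr_ge0.
move: h; rewrite {}e => h.
have : 0 <= F - 2 * (a / k) * a + (a / k) ^+ 2 * k.
  by apply: le_trans h _; rewrite lerD2l ler_wpM2l ?sqr_ge0.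
rewrite (_ : _ + _ = F - a ^+ 2 / k); last by field; lra.
by rewrite subr_ge0 ler_pdivrMr// mulrC.
Qed.

End cauchy_schwarz.

(** * Pairing a function of space and time with a product *)

Section time_pairing.
Context d (Y : measurableType d) (R : realType).
Variable nu : {sigma_finite_measure set Y -> \bar R}.
Local Notation leb := (@lebesgue_measure R).
Implicit Types (A : Y * R -> R) (b : Y -> R) (theta : R -> R).

Lemma ae_slice_time A : square_integrable (nu \x leb)%E setT A ->
  {ae leb, forall t, square_integrable nu setT (fun y => A (y, t))}.
Proof.
move=> sA; have [mA _] := sA.
have := ae_integrable2 (integrable_sqr sA); apply: filterS => t it; split.
  exact: (measurableT_comp mA (pair2_measurable t)).
exact: integrable_lty it.
Qed.

Lemma ae_slice_space A : square_integrable (nu \x leb)%E setT A ->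
  {ae nu, forall y, square_integrable leb setT (fun t => A (y, t))}.
Proof.
move=> sA; have [mA _] := sA.
have := ae_integrable1 (integrable_sqr sA); apply: filterS => t it; split.
  exact: (measurableT_comp mA (pair1_measurable t)).
exact: integrable_lty it.
Qed.

Section pairing.
Variables (A : (Y * R)%type -> R) (b : Y -> R) (theta : R -> R).
Hypothesis sA : square_integrable (nu \x leb)%E setT A.
Hypothesis sb : square_integrable nu setT b.
Hypothesis st : square_integrable leb setT theta.

Lemma integrable_pairing :
  (nu \x leb)%E.-integrable setT (fun z => (A z * (b z.1 * theta z.2))%:E).
Proof. exact: (integrable_mul sA (square_integrable_tensor sb st)). Qed.

Lemma pairing_timeE : \int[(nu \x leb)%E]_z (A z * (b z.1 * theta z.2)) =
  \int[leb]_t (theta t * \int[nu]_y (A (y, t) * b y)).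
Proof.
rewrite (Rintegral_fubini2 integrable_pairing) /=.
have [[mA _] [mb _] [mt _]] := And3 sA sb st.
apply: Rintegral_ae_eq.
- apply: (@measurable_fun_Rintegral _ _ _ _ _ nu
    (fun z => A (z.2, z.1) * (b z.2 * theta z.1))).
  apply: measurable_funM.
    by apply: (measurableT_comp mA); apply: measurable_fun_pair.
  by apply: measurable_funM; [apply: (measurableT_comp mb)|apply: (measurableT_comp mt)].
- apply: measurable_funM => //.
  apply: (@measurable_fun_Rintegral _ _ _ _ _ nu (fun z => A (z.2, z.1) * b z.2)).
  apply: measurable_funM; last exact: (measurableT_comp mb).
  by apply: (measurableT_comp mA); apply: measurable_fun_pair.
have := ae_slice_time sA. apply: (@filterS _ _ (ae_filter_ringOfSetsType _)) => t sAt.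
rewrite -RintegralZl//=; last exact: (integrable_mul sAt sb).
by apply: eq_Rintegral => y _; ring.
Qed.

Lemma pairing_spaceE : \int[(nu \x leb)%E]_z (A z * (b z.1 * theta z.2)) =
  \int[nu]_y ((\int[leb]_t (theta t * A (y, t))) * b y).
Proof.
rewrite (Rintegral_fubini1 integrable_pairing) /=.
have [[mA _] [mb _] [mt _]] := And3 sA sb st.
apply: Rintegral_ae_eq.
- apply: (@measurable_fun_Rintegral _ _ _ _ _ leb
    (fun z => A z * (b z.1 * theta z.2))).
  apply: measurable_funM => //.
  by apply: measurable_funM; [apply: (measurableT_comp mb)|apply: (measurableT_comp mt)].
- apply: measurable_funM => //.
  apply: (@measurable_fun_Rintegral _ _ _ _ _ leb (fun z => theta z.2 * A z)).
  by apply: measurable_funM => //; exact: (measurableT_comp mt).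
have := ae_slice_space sA; apply: filterS => t sAt.
rewrite -RintegralZr//=; last exact: (integrable_mul st sAt).
by apply: eq_Rintegral => y _; ring.
Qed.

(** Cauchy-Schwarz in time on each section, then Tonelli. *)
Lemma square_integrable_time_average :
  square_integrable nu setT (fun y => \int[leb]_t (theta t * A (y, t))).
Proof.
have [[mA A2] [mt t2]] := conj sA st.
have t20 : (0 <= \int[leb]_t (theta t ^+ 2)%:E)%E.
  by apply: integral_ge0 => t _; rewrite lee_fin sqr_ge0.
pose k := fine (\int[leb]_t (theta t ^+ 2)%:E) + 1.
have k0 : 0 < k by rewrite ltr_wpDl// fine_ge0.
have tk : (\int[leb]_t (theta t ^+ 2)%:E <= k%:E)%E.
  by rewrite EFinD fineK ?ge0_fin_numE// leeDl// lee_fin.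
split.
  apply: (@measurable_fun_Rintegral _ _ _ _ _ leb (fun z => theta z.2 * A z)).
  by apply: measurable_funM => //; exact: (measurableT_comp mt).
apply: (@le_lt_trans _ _ (\int[nu]_y (k%:E * \int[leb]_t (A (y, t) ^+ 2)%:E))%E).
  apply: ge0_le_integral => //.
  - by move=> y _; rewrite lee_fin sqr_ge0.
  - apply/measurable_EFinP/measurable_funX.
    apply: (@measurable_fun_Rintegral _ _ _ _ _ leb (fun z => theta z.2 * A z)).
    by apply: measurable_funM => //; exact: (measurableT_comp mt).
  - apply: measurable_funeM.
    apply: (@measurable_fun_fubini_tonelli_F _ _ _ _ _ leb (fun z => (A z ^+ 2)%:E)).
      exact/measurable_EFinP/measurable_funX.
    by move=> z; rewrite lee_fin sqr_ge0.
  - move=> y _; apply: cauchy_schwarz_bound => //.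
    exact: (measurableT_comp mA (pair1_measurable y)).
rewrite ge0_integralZl//.
- have -> : (\int[nu]_y \int[leb]_t (A (y, t) ^+ 2)%:E =
    \int[nu \x leb]_z (A z ^+ 2)%:E)%E.
    rewrite [RHS]fubini_tonelli1//.
      exact/measurable_EFinP/measurable_funX.
    by move=> z; rewrite lee_fin sqr_ge0.
  rewrite lte_mul_pinfty ?lee_fin ?(ltW k0)//.
- apply: (@measurable_fun_fubini_tonelli_F _ _ _ _ _ leb (fun z => (A z ^+ 2)%:E)).
    exact/measurable_EFinP/measurable_funX.
  by move=> z; rewrite lee_fin sqr_ge0.
- by move=> y _; apply: integral_ge0 => z _; rewrite lee_fin sqr_ge0.
- by rewrite lee_fin ltW.
Qed.

Lemma pairingB (A' B : (Y * R)%type -> R) :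
  square_integrable (nu \x leb)%E setT A' -> (forall z, B z = A z - A' z) ->
  \int[(nu \x leb)%E]_z (B z * (b z.1 * theta z.2)) =
  \int[(nu \x leb)%E]_z (A z * (b z.1 * theta z.2)) -
  \int[(nu \x leb)%E]_z (A' z * (b z.1 * theta z.2)).
Proof.
move=> sA' BE; rewrite -RintegralB//; last 2 first.
- exact: integrable_pairing.
- exact: (integrable_mul sA' (square_integrable_tensor sb st)).
by apply: eq_Rintegral => z _; rewrite BE mulrBl.
Qed.

End pairing.
End time_pairing.

(** * The fractional energy as a squared L^2 norm *)

Section energy.
Context (R : realType) (N : nat) (Omega : set 'rV[R]_N) (s : R).
Local Notation Rn := 'rV[R]_N.
Local Notation lebx := (lebesgue_rV R N).
Local Notation lebxx := (sigma_finite_prod lebx lebx).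
Hypothesis mOmega : measurable Omega.

(** The domain of integration of F_R: pairs with at least one point in Omega. *)
Definition interaction : set (Rn * Rn)%type := ~` (~` Omega `*` ~` Omega).

Lemma measurable_interaction : measurable interaction.
Proof. by apply: measurableC; apply: measurableX; exact: measurableC. Qed.

(** Nonnegativity is enough: should the constant vanish, F_R would be identically
    0 and so would [frac_weight]. *)
Lemma C_Ns_ge0 : 0 <= s -> 0 <= C_Ns N s.
Proof.
move=> s0; have Gamma_ge0 (a : R) : 0 <= Gamma a.
  by apply: Rintegral_ge0 => t _; rewrite mulr_ge0 ?powR_ge0 ?expR_ge0.
by rewrite /C_Ns !(divr_ge0, mulr_ge0, powR_ge0, pi_ge0).
Qed.

(** The square root of the kernel of F_R, constant included, so that F_R becomes
    an inner product of weighted differences. *)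
Definition frac_weight (z : Rn * Rn) : R :=
  \1_interaction z *
  Num.sqrt (C_Ns N s / 2 / enorm (z.1 - z.2) `^ (N%:R + 2 * s)).

Definition frac_diff (w : Rn -> R) (z : Rn * Rn) : R :=
  frac_weight z * (w z.1 - w z.2).

Let measurable_sqrt : measurable_fun setT (@Num.sqrt R).
Proof. by apply: continuous_measurable_fun; exact: sqrt_continuous. Qed.

Let measurable_enorm_powR (p : R) :
  measurable_fun setT (fun z : (Rn * Rn)%type => (enorm (z.1 - z.2) `^ p)^-1).
Proof.
under eq_fun do rewrite -powRN.
apply: (measurableT_comp (measurable_powR _)).
apply: (measurableT_comp measurable_sqrt).
apply: measurable_sum => i.
have mc : measurable_fun setT (fun z : (Rn * Rn)%type => (z.1 - z.2) 0 i).
  under eq_fun do rewrite !mxE.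
  by apply: measurable_funB; apply: (measurableT_comp (@measurable_coord R N i)).
exact: measurable_funM.
Qed.

Lemma measurable_frac_weight : measurable_fun setT frac_weight.
Proof.
apply: measurable_funM; first by apply: measurable_indic; apply: measurable_interaction.
apply: (measurableT_comp measurable_sqrt).
apply: measurable_funM => //; exact: measurable_enorm_powR.
Qed.

Lemma measurable_frac_diff d (X : measurableType d) (w1 w2 : X -> R)
    (p : X -> (Rn * Rn)%type) : measurable_fun setT p ->
  measurable_fun setT w1 -> measurable_fun setT w2 ->
  measurable_fun setT (fun x => frac_weight (p x) * (w1 x - w2 x)).
Proof.
move=> mp m1 m2; apply: measurable_funM; last exact: measurable_funB.
exact: (measurableT_comp measurable_frac_weight mp).
Qed.

Lemma frac_weight_sqr (z : Rn * Rn) : 0 <= s -> frac_weight z ^+ 2 =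
  \1_interaction z * (C_Ns N s / 2 / enorm (z.1 - z.2) `^ (N%:R + 2 * s)).
Proof.
move=> s0; rewrite exprMn sqr_sqrtr.
  by rewrite indicE; case: (_ \in _) => /=; rewrite ?expr0n ?expr1n.
by apply: divr_ge0; [apply: divr_ge0 => //; exact: C_Ns_ge0|exact: powR_ge0].
Qed.

Lemma frac_diffM (v w : Rn -> R) (z : Rn * Rn) : 0 <= s ->
  frac_diff v z * frac_diff w z = ((fun z => C_Ns N s / 2 *
    ((v z.1 - v z.2) * (w z.1 - w z.2) / enorm (z.1 - z.2) `^ (N%:R + 2 * s)))
    \_ interaction) z.
Proof.
move=> s0; rewrite patch_indic /=.
rewrite [LHS](_ : _ = frac_weight z ^+ 2 * ((v z.1 - v z.2) * (w z.1 - w z.2))).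
  by rewrite frac_weight_sqr//; ring.
by rewrite /frac_diff; ring.
Qed.

Lemma F_R_sqrE (w : Rn -> R) : 0 <= s -> measurable_fun setT w ->
  F_R Omega s w w = (\int[lebxx]_z (frac_diff w z ^+ 2)%:E)%E.
Proof.
move=> s0 mw; rewrite /F_R -ge0_integralZl_EFin.
- rewrite integral_mkcond; apply: eq_integral => z _.
  by rewrite expr2 frac_diffM// /patch; case: ifP.
- exact: measurable_interaction.
- by move=> z _; rewrite lee_fin divr_ge0 ?powR_ge0// -expr2 sqr_ge0.
- apply/measurable_EFinP; apply: measurable_funTS.
  have mB : measurable_fun setT (fun z : (Rn * Rn)%type => w z.1 - w z.2).
    by apply: measurable_funB; apply: (measurableT_comp mw).
  apply: measurable_funM; first exact: measurable_funM.
  exact: measurable_enorm_powR.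
- by rewrite divr_ge0// C_Ns_ge0.
Qed.

Lemma F_R_bilinearE (v w : Rn -> R) : 0 <= s ->
  measurable_fun setT v -> measurable_fun setT w ->
  fine (F_R Omega s v w) = \int[lebxx]_z (frac_diff v z * frac_diff w z).
Proof.
move=> s0 mv mw; rewrite /F_R -ge0_integralZl_measurable.
- congr fine; rewrite [LHS]integral_mkcond; apply: eq_integral => z _.
  by rewrite frac_diffM// /patch; case: ifP.
- exact: measurable_interaction.
- apply/measurable_EFinP; apply: measurable_funTS.
  apply: measurable_funM; last exact: measurable_enorm_powR.
  by apply: measurable_funM; apply: measurable_funB;
    (apply: (measurableT_comp mv) || apply: (measurableT_comp mw)).
- by rewrite divr_ge0// C_Ns_ge0.
Qed.

(** Membership in Hs amounts to two square-integrability conditions, the form in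
    which it is established and used below. *)
Lemma HsP (w : Rn -> R) : 0 <= s -> Hs Omega s w <->
  square_integrable lebx setT w /\ square_integrable lebxx setT (frac_diff w).
Proof.
move=> s0.
have I0 : (0 <= \int[lebx]_x (w x ^+ 2)%:E)%E.
  by apply: integral_ge0 => x _; rewrite lee_fin sqr_ge0.
have J0 : (0 <= \int[lebxx]_x (frac_diff w x ^+ 2)%:E)%E.
  by apply: integral_ge0 => x _; rewrite lee_fin sqr_ge0.
have finP (x y : \bar R) : (0 <= x)%E -> (0 <= y)%E ->
    (sqrte (x + y) < +oo)%E = (x < +oo)%E && (y < +oo)%E.
  move=> x0 y0; rewrite -ge0_fin_numE ?sqrte_ge0// sqrte_fin_num ?adde_ge0//.
  by rewrite fin_numD !ge0_fin_numE.
split=> [[mw]|[[mw w2] [_ d2]]].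
  rewrite /Hs_norm F_R_sqrE// finP// => /andP[w2 d2]; split; split=> //.
  apply: measurable_frac_diff => //; exact: (measurableT_comp mw).
by split=> //; rewrite /Hs_norm F_R_sqrE// finP// w2 d2.
Qed.

End energy.

(** * Time profiles *)

Section finite_range.
Context d (X : measurableType d) (R : realType) (V : Type).

(** A measurable function with finite range has measurable preimages of arbitrary
    sets; so whatever is computed from it is again measurable, with values in any
    space. *)
Lemma finite_range_preimage (q : X -> R) (B : set R) :
  measurable_fun setT q -> finite_set (range q) -> measurable (q @^-1` B).
Proof.
move=> mq fq.
have -> : q @^-1` B = \bigcup_(y in B `&` range q) (q @^-1` [set y]).
  apply/seteqP; split => [x Bx|x [y [By _] /= qxy]]; last by rewrite /= qxy.
  by exists (q x) => //; split => //; exists x.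
apply: fin_bigcup_measurable => [|y _].
  by apply: sub_finite_set fq; exact: subIsetr.
by rewrite -[X in measurable X]setTI; exact: mq.
Qed.

End finite_range.

(** Produces simple maps into function spaces from real simple functions: the
    Bochner approximations needed below all follow one direction of the target
    space. *)
Lemma simple_map_comp (R : realType) (V : zmodType) (S : set V) (q : R -> R)
    (F : R -> V) : measurable_fun setT q -> finite_set (range q) ->
  (forall c, S (F c)) -> simple_map S (F \o q).
Proof.
move=> mq fq SF; split=> [t||v]; first exact: SF.
  apply: (@sub_finite_set _ _ (F @` range q)); last exact: finite_image.
  by move=> _ [t _ <-]; exists (q t) => //; exists t.
by rewrite comp_preimage; exact: finite_range_preimage.
Qed.

Section profiles.
Context (R : realType) (T : R).
Local Notation leb := (@lebesgue_measure R).
Local Notation I := (`]0, T[%classic : set R).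

(** The time factors of test functions.  The derivative q is in the distributional
    sense on ]0, T[ and a step function, hence a Bochner simple map once multiplied
    by a fixed functional.  The nonnegativity of theta gives its monotone simple
    approximations and, later, the sign of the data. *)
Definition profile (theta q : R -> R) : Prop :=
  [/\ continuous theta, theta T = 0,
      (forall t, 0 <= theta t),
      measurable_fun setT q /\ finite_set (range q) &
      forall eta, test_function T eta ->
        \int[leb]_(t in I) (eta t * q t) =
        - \int[leb]_(t in I) (derive1 eta t * theta t)].

Lemma test_function_continuous (eta : R -> R) : test_function T eta ->
  continuous eta /\ continuous (derive1 eta).
Proof.
move=> [de _]; split=> t; apply/differentiable_continuous/derivable1_diffP.
- exact: (de 0%N).
- exact: (de 1%N).
Qed.

Lemma continuous_integrable_I (f : R -> R) : continuous f ->
  leb.-integrable I (EFin \o f).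
Proof.
move=> cf; apply: (@integrableS _ _ R leb `[0, T]%classic I) => //.
  exact: subset_itv_oo_cc.
apply: continuous_compact_integrable; first exact: segment_compact.
exact: continuous_subspaceT.
Qed.

Lemma finite_range_bounded (q : R -> R) : finite_set (range q) ->
  exists2 M, 0 < M & forall t, `|q t| <= M.
Proof.
move=> fq; exists (\sum_(y \in range q) `|y| + 1).
  by rewrite ltr_wpDl// fsumr_ge0.
move=> t; rewrite ler_wpDr// (fsbigD1 (q t))//=; last by exists t.
  by rewrite lerDl fsumr_ge0.
Qed.

Lemma finite_range_integrable (q eta : R -> R) : measurable_fun setT q ->
  finite_set (range q) -> continuous eta ->
  leb.-integrable I (EFin \o (fun t => eta t * q t)).
Proof.
move=> mq /finite_range_bounded[M M0 qM] ce.
apply: (@le_integrable _ _ R leb I _ _ (fun t => M%:E * (eta t)%:E)%E) => //.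
- apply/measurable_EFinP; apply: measurable_funM; last exact: measurable_funTS.
  by apply: measurable_funTS; exact: continuous_measurable_fun.
- move=> t _ /=; rewrite lee_fin normrM [leRHS]normrM mulrC.
  by rewrite ler_wpM2r// (gtr0_norm M0).
- exact: (integrableZl _ _ (continuous_integrable_I ce)).
Qed.

(** Trapezoids are combinations of ramps, and the derivative of a ramp is minus a
    step. *)
Definition ramp (t tau : R) : R := Num.max 0 (t - tau).
Definition step (t tau : R) : R := (tau < t)%R%:R.

Lemma ramp_continuous t : continuous (ramp t).
Proof.
move=> tau; apply: (@continuous_max _ _ (cst 0) (fun tau => t - tau)).
  exact: cvg_cst.
by apply: cvgB; [exact: cvg_cst|exact: cvg_id].
Qed.

Lemma measurable_step t : measurable_fun setT (step t).
Proof.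
rewrite (_ : step t = \1_(`]-oo, t[%classic)); first exact: measurable_indic.
apply/funext => tau; rewrite indicE /step; congr ((nat_of_bool _)%:R).
by apply/idP/idP; rewrite in_setE /= in_itv.
Qed.

Lemma finite_range_step t : finite_set (range (step t)).
Proof.
apply: (@sub_finite_set _ _ [set 0; 1]); last exact: finite_set2.
by move=> _ [tau _ <-]; rewrite /step; case: ltP; [right|left].
Qed.

(** Integration by parts on [0, t]: the boundary terms vanish because the ramp is
    0 at t and the test function is 0 at 0.  For t <= 0 both factors vanish on
    ]0, T[. *)
Lemma ramp_by_parts (t : R) (eta : R -> R) : t <= T -> test_function T eta ->
  \int[leb]_(tau in I) (eta tau * step t tau) =
  \int[leb]_(tau in I) (derive1 eta tau * ramp t tau).
Proof.
move=> tT te; have [ce cde] := test_function_continuous te.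
have [de [a [b [a0 bT eta0]]]] := te.
have [t0|t0] := leP t 0.
  apply: eq_Rintegral => tau; rewrite inE/= in_itv/= => /andP[/ltW tau0 _].
  rewrite /step ltNge (le_trans t0 tau0) /ramp max_l ?mulr0//.
  by rewrite subr_le0 (le_trans t0).
have restr (g : R -> R) : (forall tau, t <= tau -> g tau = 0) ->
    \int[leb]_(tau in I) g tau = \int[leb]_(tau in `]0, t[) g tau.
  move=> g0; rewrite Rintegral_mkcond [RHS]Rintegral_mkcond.
  apply: eq_Rintegral => tau _; rewrite /patch /=.
  case: ifPn => [|]; rewrite ?inE ?notin_setE/= in_itv/=.
    move=> /andP[tau0 tauT]; case: ifPn => //.
    by rewrite notin_setE/= in_itv/= tau0/= => /negP; rewrite -leNgt => /g0.
  move=> h; case: ifPn => //; rewrite inE/= in_itv/= => /andP[tau0 taut].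
  by exfalso; apply: h; rewrite tau0 (lt_le_trans taut).
rewrite restr; last by move=> tau ttau; rewrite /step ltNge ttau mulr0.
rewrite [RHS]restr; last by move=> tau ttau; rewrite /ramp max_l ?mulr0// subr_le0.
rewrite (@eq_Rintegral _ _ _ leb _ (fun tau => -1 * (eta tau * -1))); last first.
  by move=> tau; rewrite inE/= in_itv/= => /andP[_ tt]; rewrite /step tt/=; ring.
rewrite [RHS](@eq_Rintegral _ _ _ leb _ (fun tau => derive1 eta tau * (t - tau)));
    last first.
  move=> tau; rewrite inE/= in_itv/= => /andP[_ tt].
  by rewrite /ramp max_r// subr_ge0 ltW.
have clos (f : R -> R) : continuous f ->
    \int[leb]_(tau in `]0, t[) f tau = \int[leb]_(tau in `[0, t]) f tau.
  move=> cf; rewrite /Rintegral; congr fine; rewrite (@integral_itv_bndoo _ 0 t (EFin \o f) true false)//.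
  by apply/measurable_EFinP; apply: measurable_funTS; exact: continuous_measurable_fun.
have cB : continuous (fun tau : R => t - tau).
  by move=> tau; apply: cvgB; [exact: cvg_cst|exact: cvg_id].
have ce1 : continuous (fun tau => eta tau * -1).
  by move=> tau; apply: cvgM; [exact: ce|exact: cvg_cst].
rewrite !clos; last 2 first.
  by move=> tau; apply: cvgM; [exact: cde|exact: cB].
  by move=> tau; apply: cvgM; [exact: cvg_cst|exact: ce1].
have LR (f : R -> R) : continuous f -> (forall x, derivable f x 1) ->
    derivable_oo_LRcontinuous f 0 t.
  move=> cf df; split=> [x _| |]; first exact: df.
  - exact: cvg_at_right_filter (cf _).
  - exact: cvg_at_left_filter (cf _).
rewrite RintegralZl//=; last first.
  by apply: continuous_compact_integrable;
    [exact: segment_compact|exact: continuous_subspaceT].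
rewrite (@Rintegration_by_parts R eta (fun tau => t - tau) (derive1 eta) (fun=> -1)
  0 t t0).
- by rewrite subrr (eta0 0) ?subr0 -?ltNge ?(lt_geF a0)//; ring.
- exact: continuous_subspaceT.
- by apply: LR; [exact: ce|move=> x; exact: (de 0%N)].
- by [].
- by apply: continuous_subspaceT => x; exact: cvg_cst.
- by apply: LR; [exact: cB|move=> x; exact: derivableB].
- by move=> x _; rewrite derive1E deriveB// derive_cst derive_id sub0r.
Qed.

End profiles.

(** * Trapezoidal profiles *)

(** The indicator function of [a - h, a[, for nonnegative h. *)
Definition window (R : realType) (h a tau : R) : R := step a tau - step (a - h) tau.

Section trapezoid.
Context (R : realType) (T : R).
Local Notation leb := (@lebesgue_measure R).
Local Notation I := (`]0, T[%classic : set R).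
Variables (h D t : R).
Hypotheses (h0 : 0 <= h) (D0 : 0 <= D) (tT : t <= T).

(** The integral over b in [t - D, t] of the windows of length h ending at b: for
    D <= h it equals D on [t - h, t - D], and it is supported in [t - h - D, t]. *)
Definition trapezoid (tau : R) : R :=
  ramp t tau - ramp (t - D) tau - ramp (t - h) tau + ramp (t - h - D) tau.

Definition trapezoid_deriv (tau : R) : R :=
  - (window h t tau - window h (t - D) tau).

Let rampE (a tau : R) : ramp a tau = (a - tau) * step a tau.
Proof.
rewrite /ramp /step; have [ta|ta] := ltP tau a.
  by rewrite max_r ?mulr1// subr_ge0 ltW.
by rewrite max_l ?mulr0// subr_le0.
Qed.

(** A mixed second difference of the positive part, which is convex. *)
Lemma trapezoid_ge0 tau : 0 <= trapezoid tau.
Proof.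
move: h0 D0 => h1 D1; rewrite /trapezoid !rampE /step.
case: (ltP tau t) => a1; case: (ltP tau (t - h)) => a2;
  case: (ltP tau (t - D)) => a3; case: (ltP tau (t - h - D)) => a4 /=; lra.
Qed.

(** A trapezoid differs from D times a window only on its two slopes. *)
Lemma trapezoid_approx tau : D <= h ->
  `|D * window h t tau - trapezoid tau| <=
  D * (window D t tau + window D (t - h) tau).
Proof.
move: h0 D0 => h1 D1 Dh; rewrite ler_norml /window /trapezoid !rampE /step.
case: (ltP tau t) => a1; case: (ltP tau (t - h)) => a2;
  case: (ltP tau (t - D)) => a3; case: (ltP tau (t - h - D)) => a4 /=;
  apply/andP; split; lra.
Qed.

Lemma trapezoid_profile : profile T trapezoid trapezoid_deriv.
Proof.
move: h0 D0 tT => h1 D1 tT1.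
have rT a : a <= T -> ramp a T = 0 by move=> aT; rewrite /ramp max_l// subr_le0.
split.
- move=> tau; apply: cvgD; last exact: ramp_continuous.
  by apply: cvgB; [apply: cvgB|]; exact: ramp_continuous.
- by rewrite /trapezoid !rT ?subr0 ?addr0//; lra.
- by move=> tau; exact: trapezoid_ge0.
- split.
    by rewrite /trapezoid_deriv /window; apply: measurable_funN;
      apply: measurable_funB; apply: measurable_funB; exact: measurable_step.
  apply: (@sub_finite_set _ _ ((fun b : bool * bool * (bool * bool) =>
    - ((nat_of_bool b.1.1)%:R - (nat_of_bool b.1.2)%:R -
      ((nat_of_bool b.2.1)%:R - (nat_of_bool b.2.2)%:R)) : R) @` setT)).
    by move=> _ [tau _ <-]; exists ((tau < t, tau < t - h),
      (tau < t - D, tau < t - D - h)).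
  by apply: finite_image; exact: finite_finset.
move=> eta te; have [ce cde] := test_function_continuous te.
have i1 a := finite_range_integrable T (measurable_step a) (finite_range_step a) ce.
have i2 a : leb.-integrable I (EFin \o (fun tau => derive1 eta tau * ramp a tau)).
  apply: continuous_integrable_I => tau; apply: cvgM; first exact: cde.
  exact: ramp_continuous.
have e1 := ramp_by_parts tT1 te.
have tDT : t - D <= T by move: tT1; lra.
have thT : t - h <= T by move: tT1; lra.
have thDT : t - h - D <= T by move: tT1; lra.
have e2 := ramp_by_parts tDT te.
have e3 := ramp_by_parts thT te.
have e4 := ramp_by_parts thDT te.
have ijB f g : leb.-integrable I (EFin \o f) -> leb.-integrable I (EFin \o g) ->
  leb.-integrable I (EFin \o (fun tau => f tau - g tau)).
  by move=> jf jg; refine (@integrableB _ _ R leb I _ _ _ jf jg).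
have ijD f g : leb.-integrable I (EFin \o f) -> leb.-integrable I (EFin \o g) ->
  leb.-integrable I (EFin \o (fun tau => f tau + g tau)).
  by move=> jf jg; refine (@integrableD _ _ R leb I _ _ _ jf jg).
transitivity (- (\int[leb]_(tau in I) (eta tau * step t tau) -
  \int[leb]_(tau in I) (eta tau * step (t - D) tau) -
  \int[leb]_(tau in I) (eta tau * step (t - h) tau) +
  \int[leb]_(tau in I) (eta tau * step (t - h - D) tau))).
  have j1 := ijB _ _ (i1 t) (i1 (t - D)).
  have j2 := ijB _ _ j1 (i1 (t - h)).
  have j3 := ijD _ _ j2 (i1 (t - h - D)).
  rewrite -RintegralB// -RintegralB// -RintegralD// -mulN1r -RintegralZl//.
  apply: eq_Rintegral => tau _; rewrite /trapezoid_deriv /window.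
  by rewrite (_ : t - D - h = t - h - D); last ring; ring.
rewrite e1 e2 e3 e4; congr (- _).
have j1 := ijB _ _ (i2 t) (i2 (t - D)).
have j2 := ijB _ _ j1 (i2 (t - h)).
rewrite -RintegralB// -RintegralB// -RintegralD//.
by apply: eq_Rintegral => tau _; rewrite /trapezoid; ring.
Qed.

End trapezoid.

(** * Products of a profile and a function of space as test functions *)

Section product_test.
Context (R : realType) (N : nat) (Omega : set 'rV[R]_N) (s T : R).
Local Notation Rn := 'rV[R]_N.
Local Notation lebx := (lebesgue_rV R N).
Local Notation lebxx := (sigma_finite_prod lebx lebx).
Local Notation leb := (@lebesgue_measure R).
Local Notation I := (`]0, T[%classic : set R).
Hypotheses (mOmega : measurable Omega) (s0 : 0 <= s) (T0 : 0 < T).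

Lemma HsZ (a : R) (w : Rn -> R) : Hs Omega s w -> Hs Omega s (fun x => a * w x).
Proof.
move=> /(HsP mOmega _ s0)[w2 d2]; apply/(HsP mOmega _ s0); split.
  exact: square_integrableZ.
rewrite (_ : frac_diff Omega s _ = fun z => a * frac_diff Omega s w z).
  exact: square_integrableZ.
by apply/funext => z; rewrite /frac_diff; ring.
Qed.

Lemma Hs0 : Hs Omega s (fun=> 0).
Proof.
have s2 d (X : measurableType d) (m : {measure set X -> \bar R}) :
    square_integrable m setT (fun=> 0 : R).
  by split=> //; rewrite integral0_eq// => x _; rewrite expr0n.
apply/(HsP mOmega _ s0); split=> //.
rewrite (_ : frac_diff Omega s _ = fun=> 0); first exact: s2.
by apply/funext => z; rewrite /frac_diff subrr mulr0.
Qed.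

(** Homogeneity of the norm reduces the convergence of the approximations of
    theta(t) psi in Hs to that of real numbers. *)
Lemma Hs_normZ (a : R) (w : Rn -> R) : Hs Omega s w ->
  Hs_norm Omega s (fun x => a * w x) = (`|a|%:E * Hs_norm Omega s w)%E.
Proof.
move=> Hw; have [w2 d2] := (HsP mOmega w s0).1 Hw; have [mw _] := w2.
have maw : measurable_fun setT (fun x => a * w x) by exact: measurable_funM.
rewrite /Hs_norm !F_R_sqrE// -[`|a|%:E]/(`|a%:E|%E) -sqrte_sqr -sqrteM ?sqre_ge0//.
congr sqrte; rewrite ge0_muleDr; last 2 first.
- by apply: integral_ge0 => x _; rewrite lee_fin sqr_ge0.
- by apply: integral_ge0 => x _; rewrite lee_fin sqr_ge0.
rewrite -EFin_expe -!integralZl//=; [|exact: integrable_sqr..].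
congr (_ + _)%E; apply: eq_integral => x _; rewrite -EFinM; congr EFin; first by ring.
by rewrite /frac_diff; ring.
Qed.

Lemma HsN_fin (w : Rn -> R) : Hs Omega s w -> Hs_norm Omega s w \is a fin_num.
Proof. by move=> [_ w2]; rewrite ge0_fin_numE// sqrte_ge0. Qed.

Definition product_test (theta : R -> R) (psi : Rn -> R) (z : Rn * R) : R :=
  theta z.2 * psi z.1.

(** A multiple of the functional that the pivot space L^2(Omega) attaches to
    psi. *)
Definition pivot (psi : Rn -> R) (c : R) (w : Rn -> R) : R :=
  c * \int[lebx]_(x in Omega) (psi x * w x).

Definition product_test_deriv (q : R -> R) (psi : Rn -> R) : R -> (Rn -> R) -> R :=
  pivot psi \o q.

Section fixed.
Variables (theta q : R -> R) (psi : Rn -> R).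
Hypotheses (tp : profile T theta q) (Hpsi : Hs Omega s psi).

Let mtheta : measurable_fun setT theta.
Proof. by have [ct _ _ _ _] := tp; exact: continuous_measurable_fun. Qed.

Let psi2 : square_integrable lebx setT psi.
Proof. by have [] := (HsP mOmega psi s0).1 Hpsi. Qed.

Lemma integrable_Omega_mul (v w : Rn -> R) : square_integrable lebx setT v ->
  square_integrable lebx setT w ->
  lebx.-integrable Omega (EFin \o (fun x => v x * w x)).
Proof.
move=> v2 w2; apply: (@integrableS _ _ R lebx setT) => //.
exact: (integrable_mul v2 w2).
Qed.

Lemma product_test_L2_Hs : L2_Hs Omega s T (product_test theta psi).
Proof.
have [ct tT t0 [mq fq] tq] := tp.
split.
  apply: measurable_funTS; apply: measurable_funM.
    exact: (measurableT_comp mtheta).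
  by apply: (measurableT_comp _ measurable_fst); have [] := psi2.
split.
- by apply: aeW => t _; exact: (HsZ (theta t) Hpsi).
- have mI : measurable I by [].
  have mtI : measurable_fun I (EFin \o theta).
    exact/measurable_EFinP/measurable_funTS.
  pose a n t : R := nnsfun_approx mI mtI n t.
  have aP n : measurable_fun setT (a n) /\ finite_set (range (a n)).
    by split; [exact: measurable_funPT|exact: fimfunP].
  exists (fun n => (fun c x => c * psi x) \o a n).
    move=> n; have [ma fa] := aP n.
    by apply: simple_map_comp => // c; exact: (HsZ c Hpsi).
  apply: aeW => t It; set k := fine (Hs_norm Omega s psi).
  rewrite (_ : (fun n => _) = fun n => (`|a n t - theta t| * k)%:E); last first.
    apply/funext => n; rewrite EFinM fineK ?HsN_fin// -Hs_normZ//.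
    by congr Hs_norm; apply/funext => x; rewrite /= mulrBl.
  have t0' x : I x -> (0 <= (EFin \o theta) x)%E by rewrite lee_fin.
  have /fine_cvgP[_ at_] := cvg_nnsfun_approx mI mtI t0' It.
  apply/fine_cvgP; split; first exact: nearW.
  rewrite -[X in _ --> X](mul0r k) -[X in X * k](normr0 R) -[X in `|X|](subrr (theta t)).
  apply: cvgM; last exact: cvg_cst.
  by apply: cvg_norm; apply: cvgB; [exact: at_|exact: cvg_cst].
- set k := fine (Hs_norm Omega s psi).
  rewrite (@eq_integral _ _ R leb I (fun t => ((theta t * k) ^+ 2)%:E)); last first.
    move=> t _; rewrite [Hs_norm _ _ _](Hs_normZ (theta t) Hpsi).
    rewrite -[Hs_norm _ _ _]fineK ?HsN_fin//.
    by rewrite -/k -EFinM -EFin_expe !exprMn real_normK ?num_real.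
  apply: (integrable_lty (mu := leb)) => //.
  apply: continuous_integrable_I => t.
  by apply: cvgM; apply: cvgM; (exact: ct || exact: cvg_cst).
Qed.

Let k := fine (\int[lebx]_x ((psi \_ Omega) x ^+ 2)%:E) + 1.

(** The norm of Hs dominates that of L^2(R^N). *)
Lemma pivot_bound (c : R) (w : Rn -> R) : Hs Omega s w ->
  (Hs_norm Omega s w <= 1)%E -> `|pivot psi c w| <= `|c| * (k + 1).
Proof.
move=> Hw w1; have [w2 d2] := (HsP mOmega w s0).1 Hw; have [mw _] := w2.
have psiO2 : square_integrable lebx setT (psi \_ Omega).
  by apply: square_integrable_patch => //; exact: (square_integrableS _ _ _ psi2).
have fin_psi : (\int[lebx]_x ((psi \_ Omega) x ^+ 2)%:E)%E \is a fin_num.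
  rewrite ge0_fin_numE; first by case: psiO2.
  by apply: integral_ge0 => x _; rewrite lee_fin sqr_ge0.
have k0 : 0 < k.
  rewrite /k ltr_wpDl// -lee_fin fineK//.
  by apply: integral_ge0 => x _; rewrite lee_fin sqr_ge0.
have W1 : (\int[lebx]_x (w x ^+ 2)%:E <= 1)%E.
  have X0 : (0 <= \int[lebx]_x (w x ^+ 2)%:E)%E.
    by apply: integral_ge0 => x _; rewrite lee_fin sqr_ge0.
  have Y0 : (0 <= F_R Omega s w w)%E.
    rewrite F_R_sqrE//.
    by apply: integral_ge0 => x _; rewrite lee_fin sqr_ge0.
  apply: (@le_trans _ _ (\int[lebx]_x (w x ^+ 2)%:E + F_R Omega s w w)%E).
    exact: leeDl.
  rewrite (_ : (_ + _)%E = (Hs_norm Omega s w ^+ 2)%E); last first.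
    by rewrite /Hs_norm sqr_sqrte// adde_ge0.
  rewrite expe2 -[leRHS]mule1.
  by apply: lee_pmul; rewrite ?sqrte_ge0.
rewrite normrM ler_wpM2l//.
rewrite (_ : \int[lebx]_(x in Omega) _ = \int[lebx]_x ((psi \_ Omega) x * w x)).
  have := @cauchy_schwarz_bound _ _ R lebx k w (psi \_ Omega) k0 mw psiO2.
  have le_k : (\int[lebx]_x ((psi \_ Omega) x ^+ 2)%:E <= k%:E)%E.
    by rewrite /k EFinD fineK// leeDl// lee_fin.
  move=> /(_ le_k) h.
  have {}h : (\int[lebx]_x ((psi \_ Omega) x * w x)) ^+ 2 <= k.
    rewrite -lee_fin (le_trans h)// -[leRHS]mule1 lee_wpmul2l// lee_fin.
    exact: ltW.
  rewrite ler_norml; apply/andP; split; move: k0; nra.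
rewrite Rintegral_mkcond; apply: eq_Rintegral => x _.
by rewrite /patch; case: ifP; rewrite ?mul0r.
Qed.

Let q_bound : exists2 M, 0 < M & forall t, `|q t| <= M.
Proof. by have [_ _ _ [_ fq] _] := tp; exact: finite_range_bounded. Qed.

Let k_ge0 : 0 <= k.
Proof. by rewrite addr_ge0// fine_ge0// integral_ge0// => x _; rewrite lee_fin sqr_ge0. Qed.

Lemma pivot_norm_le (c : R) :
  (0 <= Hs_dual_norm Omega s (pivot psi c) <= (`|c| * (k + 1))%:E)%E.
Proof.
apply/andP; split.
  apply: ereal_sup_ubound; exists (fun=> 0); last first.
    rewrite /pivot (_ : \int[lebx]_(x in Omega) _ = 0) ?mulr0 ?normr0//.
    by under eq_Rintegral do rewrite mulr0; rewrite Rintegral_cst// mul0r.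
  split; first exact: Hs0.
  have -> : (fun=> 0) = (fun x => 0 * psi x) by apply/funext => x; rewrite mul0r.
  by rewrite Hs_normZ// normr0 mul0e lee01.
by apply: ge_ereal_sup => _ [w [Hw w1] <-]; rewrite lee_fin pivot_bound.
Qed.

Lemma pivot_Hs_dual (c : R) : Hs_dual Omega s (pivot psi c).
Proof.
split; last first.
  by have /andP[_ h] := pivot_norm_le c; exact: le_lt_trans h (ltry _).
move=> a u v /(HsP mOmega _ s0)[u2 _] /(HsP mOmega _ s0)[v2 _].
rewrite /pivot (@eq_Rintegral _ _ _ lebx Omega
  (fun x => a * (psi x * u x) + psi x * v x)); last by move=> x _; ring.
have iu := integrable_Omega_mul psi2 u2; have iv := integrable_Omega_mul psi2 v2.
rewrite RintegralD//; last exact: (integrableZl mOmega a iu).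
by rewrite RintegralZl//; ring.
Qed.

(** All values lie on the line spanned by one functional and the coefficient q is a
    step function, so the derivative is its own simple approximation; the defining
    identity is the integration by parts of [profile], times a constant. *)
Lemma product_test_time_derivative :
  time_derivative Omega s T (product_test theta psi) (product_test_deriv q psi).
Proof.
have [ct tT t0 [mq fq] tq] := tp; have [M M0 qM] := q_bound.
have mI : measurable I by [].
split.
  split.
  - by apply: aeW => t _; exact: pivot_Hs_dual.
  - exists (fun=> product_test_deriv q psi).
      by move=> _; apply: simple_map_comp => // c; exact: pivot_Hs_dual.
    apply: aeW => t _; rewrite subrr.
    have -> : 0 = pivot psi 0 by apply/funext => w; rewrite /pivot mul0r.
    have /andP[h1 h2] := pivot_norm_le 0; rewrite normr0 mul0r in h2.
    have -> : Hs_dual_norm Omega s (pivot psi 0) = 0%E.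
      by apply/eqP; rewrite eq_le h1 h2.
    exact: cvg_cst.
  - apply: (@le_lt_trans _ _ (\int[leb]_(t in I) ((M * (k + 1)) ^+ 2)%:E)%E).
      apply: ge0_le_integral => //.
      + by move=> t _; exact: sqre_ge0.
      + move=> _ Y mY; apply: measurableI => //.
        exact: (@finite_range_preimage _ _ _ q
          ((fun c => Hs_dual_norm Omega s (pivot psi c) ^+ 2)%E @^-1` Y)).
      + move=> t _; rewrite EFin_expe !expe2.
        have /andP[h1 h2] := pivot_norm_le (q t).
        have h3 : (Hs_dual_norm Omega s (pivot psi (q t)) <= (M * (k + 1))%:E)%E.
          by apply: le_trans h2 _; rewrite lee_fin ler_wpM2r// addr_ge0.
        exact: lee_pmul.
    apply: (@integrable_lty _ _ R leb I) => //.
    by apply: (@continuous_integrable_I _ T (cst ((M * (k + 1)) ^+ 2))) => t; exact: cvg_cst.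
move=> eta psi' te /(HsP mOmega _ s0)[psi'2 _].
have [ce cde] := test_function_continuous te.
set c := \int[lebx]_(x in Omega) (psi x * psi' x).
transitivity ((\int[leb]_(t in I) (eta t * q t)) * c).
  rewrite -RintegralZr//; last exact: finite_range_integrable.
  by apply: eq_Rintegral => t _; rewrite /product_test_deriv /pivot /= mulrA.
rewrite tq// mulNr; congr (- _).
rewrite -RintegralZr//; last first.
  by apply: continuous_integrable_I => t; apply: cvgM; [exact: cde|exact: ct].
apply: eq_Rintegral => t _; rewrite -mulrA; congr (_ * _).
rewrite /c -RintegralZl//; last exact: integrable_Omega_mul.
by apply: eq_Rintegral => x _; rewrite /product_test /= mulrA.
Qed.

(** The product is continuous in time with values in L^2(Omega) because theta is
    continuous. *)
Lemma product_test_time_value (t0 : R) : t0 \in `[0, T] ->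
  time_value Omega T (product_test theta psi) t0 (fun x => theta t0 * psi x).
Proof.
have [ct tT _ _ _] := tp.
have psiO : square_integrable lebx Omega psi.
  exact: (square_integrableS _ _ _ psi2).
have cO (c : R) : square_integrable lebx Omega (fun x => c * psi x).
  apply: (square_integrableS _ _ _ (square_integrableZ c psi2)) => //.
move=> t0T; split; first exact: cO.
exists (fun t x => theta t * psi x); split.
- move=> t tT'; split; first exact: cO.
  set K := fine (\int[lebx]_(x in Omega) (psi x ^+ 2)%:E)%E.
  have KE : (\int[lebx]_(x in Omega) (psi x ^+ 2)%:E)%E = K%:E.
    rewrite fineK// ge0_fin_numE; first by case: psiO.
    by apply: integral_ge0 => x _; rewrite lee_fin sqr_ge0.
  rewrite (_ : (fun r => _) = fun r => ((theta r - theta t) ^+ 2 * K)%:E); last first.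
    apply/funext => r; rewrite EFinM -KE -ge0_integralZl_EFin ?sqr_ge0//.
    + by apply: eq_integral => x _; rewrite -EFinM; congr EFin; ring.
    + by move=> x _; rewrite lee_fin sqr_ge0.
    + apply/measurable_EFinP; apply: measurable_funX.
      by apply: measurable_funTS; have [] := psi2.
  apply/fine_cvgP; split; first exact: nearW.
  apply: cvg_within_filter.
  have h : ((theta r - theta t) * (theta r - theta t) * K) @[r --> t] -->
      (theta t - theta t) * (theta t - theta t) * K.
    apply: cvgM; last exact: cvg_cst.
    by apply: cvgM; apply: cvgB; (exact: ct || exact: cvg_cst).
  by move: h; rewrite subrr !mul0r.
- by apply: aeW => t _; apply: aeW.
- exact: aeW.
Qed.

Lemma product_test_W : W Omega s T (product_test theta psi).
Proof.
split; first exact: product_test_L2_Hs.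
by exists (product_test_deriv q psi); exact: product_test_time_derivative.
Qed.

Lemma product_test_HQ : HQ Omega s T (product_test theta psi).
Proof.
split; first exact: product_test_W.
have [_ tT _ _ _] := tp.
rewrite (_ : cst 0 = fun x => theta T * psi x); last first.
  by apply/funext => x; rewrite tT mul0r.
by apply: product_test_time_value; rewrite in_itv/= lexx ltW.
Qed.

End fixed.
End product_test.

(** * The weak form tested by products *)

Section weak.
Context (R : realType) (N : nat) (Omega : set 'rV[R]_N) (s T : R).
Local Notation Rn := 'rV[R]_N.
Local Notation lebx := (lebesgue_rV R N).
Local Notation lebxx := (sigma_finite_prod lebx lebx).
Local Notation leb := (@lebesgue_measure R).
Local Notation I := (`]0, T[%classic : set R).
Hypotheses (mOmega : measurable Omega) (s0 : 0 <= s) (T0 : 0 < T).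

Definition frac_lift (P : Rn * R -> R) (z : (Rn * Rn) * R) : R :=
  frac_diff Omega s (slice P z.2) z.1.

Lemma measurable_frac_lift (P : Rn * R -> R) : measurable_fun setT P ->
  measurable_fun setT (frac_lift P).
Proof.
move=> mP; apply: measurable_frac_diff => //.
- apply: (measurableT_comp mP); apply: measurable_fun_pair => //.
  exact: (measurableT_comp measurable_fst).
- apply: (measurableT_comp mP); apply: measurable_fun_pair => //.
  exact: (measurableT_comp measurable_snd).
Qed.

Let mI : measurable I. Proof. by []. Qed.

Let mRI : measurable ([set: Rn] `*` I). Proof. exact: measurableX. Qed.

(** Extension by 0 outside the time interval, so that all the integrals in time
    run over the real line. *)
Definition time_restr (rho : Rn * R -> R) : Rn * R -> R := rho \_ (setT `*` I).

Lemma time_restr_slice (rho : Rn * R -> R) (t : R) : I t ->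
  slice (time_restr rho) t = slice rho t.
Proof.
by move=> It; apply/funext => x; rewrite /slice /time_restr patchE mem_set.
Qed.

Lemma time_restr_out (rho : Rn * R -> R) (x : Rn) (t : R) : ~ I t -> time_restr rho (x, t) = 0.
Proof. by move=> It; rewrite /time_restr patchE memNset// => -[]. Qed.

(** On ]0, T[ the squared norm of Hs is the sum of the two section integrals, and
    Tonelli makes both integrable over space and time. *)
Lemma L2_Hs_time_restr (rho : Rn * R -> R) : L2_Hs Omega s T rho ->
  square_integrable (lebx \x leb)%E setT (time_restr rho) /\
  square_integrable (lebxx \x leb)%E setT (frac_lift (time_restr rho)).
Proof.
move=> [mrho [_ _ rho2]].
have mP : measurable_fun setT (time_restr rho) := (measurable_restrictT rho mRI).1 mrho.
have mF := measurable_frac_lift mP.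
have mP2 : measurable_fun setT (fun z => (time_restr rho z ^+ 2)%:E).
  exact/measurable_EFinP/measurable_funX.
have mF2 : measurable_fun setT (fun z => (frac_lift (time_restr rho) z ^+ 2)%:E).
  exact/measurable_EFinP/measurable_funX.
have P0 z : (0 <= (time_restr rho z ^+ 2)%:E)%E by rewrite lee_fin sqr_ge0.
have F0 z : (0 <= (frac_lift (time_restr rho) z ^+ 2)%:E)%E by rewrite lee_fin sqr_ge0.
have mG1 := measurable_fun_fubini_tonelli_G (m1 := lebx) _ mP2 P0.
have mG2 := measurable_fun_fubini_tonelli_G (m1 := lebxx) _ mF2 F0.
set G1 := fubini_G lebx _ in mG1; set G2 := fubini_G lebxx _ in mG2.
have G10 t : (0 <= G1 t)%E by apply: integral_ge0 => x _; exact: P0.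
have G20 t : (0 <= G2 t)%E by apply: integral_ge0 => x _; exact: (F0 (x, t)).
have E : (\int[leb]_(t in I) G1 t + \int[leb]_(t in I) G2 t < +oo)%E.
  rewrite -ge0_integralD//; [|exact: measurable_funTS..].
  apply: le_lt_trans rho2; rewrite le_eqVlt; apply/orP; left; apply/eqP.
  apply: eq_integral => t /set_mem It; rewrite -(time_restr_slice rho It).
  have mt : measurable_fun setT (slice (time_restr rho) t).
    exact: (measurableT_comp mP (pair2_measurable t)).
  by rewrite /Hs_norm F_R_sqrE// sqr_sqrte//; exact: adde_ge0 (G10 t) (G20 t).
have I10 : (0 <= \int[leb]_(t in I) G1 t)%E by exact: integral_ge0.
have I20 : (0 <= \int[leb]_(t in I) G2 t)%E by exact: integral_ge0.
split; split=> //.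
- have -> : (\int[lebx \x leb]_z (time_restr rho z ^+ 2)%:E = \int[leb]_(t in I) G1 t)%E.
    transitivity (\int[leb]_t G1 t)%E; first exact: fubini_tonelli2.
    rewrite [RHS]integral_mkcond.
    apply: eq_integral => t _; rewrite patchE; case: ifPn => // /negP It.
    by apply: integral0_eq => x _; rewrite time_restr_out ?expr0n// => /mem_set.
  by apply: le_lt_trans E; exact: leeDl.
- have -> : (\int[lebxx \x leb]_z (frac_lift (time_restr rho) z ^+ 2)%:E =
      \int[leb]_(t in I) G2 t)%E.
    transitivity (\int[leb]_t G2 t)%E; first exact: fubini_tonelli2.
    rewrite [RHS]integral_mkcond.
    apply: eq_integral => t _; rewrite patchE; case: ifPn => // /negP It.
    apply: integral0_eq => x _; rewrite /frac_lift /frac_diff /slice.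
    by rewrite !time_restr_out ?subrr ?mulr0 ?expr0n// => /mem_set.
  by apply: le_lt_trans E; exact: leeDr.
Qed.

Section test.
Variables (theta q : R -> R) (psi : Rn -> R).
Hypotheses (tp : profile T theta q) (Hpsi : Hs Omega s psi).

Lemma profile_sqi : square_integrable leb setT (theta \_ I) /\
  square_integrable leb setT (q \_ I).
Proof.
have [ct _ _ [mq fq] _] := tp; have [M M0 qM] := finite_range_bounded fq.
split; apply: square_integrable_patch => //; split.
- by apply: measurable_funTS; exact: continuous_measurable_fun.
- apply: (@integrable_lty _ _ R leb I) => //.
  by apply: continuous_integrable_I => t; apply: cvgM; exact: ct.
- exact: measurable_funTS.
- apply: (@le_lt_trans _ _ (\int[leb]_(t in I) (M ^+ 2)%:E)%E).
    apply: ge0_le_integral => //.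
    + by move=> t _; rewrite lee_fin sqr_ge0.
    + by apply/measurable_EFinP/measurable_funX; exact: measurable_funTS.
    + move=> t _; rewrite lee_fin -(real_normK (num_real (q t))).
      by rewrite lerXn2r ?nnegrE// ltW.
  apply: (@integrable_lty _ _ R leb I) => //.
  by apply: (@continuous_integrable_I _ T (cst (M ^+ 2))) => t; exact: cvg_cst.
Qed.

Lemma square_integrable_indic (D : set Rn) (P : Rn * R -> R) : measurable D ->
  square_integrable (lebx \x leb)%E setT P ->
  square_integrable (lebx \x leb)%E setT (fun z => \1_D z.1 * P z).
Proof.
move=> mD sP; have [mP _] := sP; apply: square_integrable_le sP.
  apply: measurable_funM => //.
  by apply: (measurableT_comp _ measurable_fst); exact: measurable_indic.
move=> z; rewrite normrM indicE; case: (_ \in _) => /=.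
  by rewrite normr1 mul1r.
by rewrite normr0 mul0r.
Qed.

End test.

(** The weak formulation for test functions theta(t) psi(x), with all its terms
    but the initial one written as integrals over space and time. *)
Definition weak_form (f g : Rn * R -> R) (rho0 : Rn -> R) (P : Rn * R -> R) : Prop :=
  forall theta q psi, profile T theta q -> Hs Omega s psi ->
  - (\int[(lebx \x leb)%E]_z (\1_Omega z.1 * P z * (psi z.1 * (q \_ I) z.2)))
  + (\int[(lebxx \x leb)%E]_z
      (frac_lift P z * (frac_diff Omega s psi z.1 * (theta \_ I) z.2)))
  + (\int[(lebx \x leb)%E]_z
      (\1_(~` Omega) z.1 * P z * (psi z.1 * (theta \_ I) z.2)))
  = (\int[(lebx \x leb)%E]_z ((f \_ (cylQ Omega T)) z * (psi z.1 * (theta \_ I) z.2)))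
  + (\int[(lebx \x leb)%E]_z ((g \_ (cylSigma Omega T)) z * (psi z.1 * (theta \_ I) z.2)))
  + (\int[lebx]_(x in Omega) (rho0 x * (theta 0 * psi x))).

(** Fubini, and the expression of F_R by [frac_diff]. *)
Lemma weak_solution_weak_form (f g : Rn * R -> R) (rho0 : Rn -> R) (rho : Rn * R -> R) :
  weak_solution Omega s T f g rho0 rho -> weak_form f g rho0 (time_restr rho).
Proof.
have congr_terms (a a' b b' c c' : R) : a = a' -> b = b' -> c = c' ->
    - a + b + c = - a' + b' + c' by move=> -> -> ->.
move=> [[L2rho _] weak] theta q psi tp Hpsi; have [sP sF] := L2_Hs_time_restr L2rho.
have [spsi sfpsi] := (HsP mOmega psi s0).1 Hpsi.
have [st sq] := profile_sqi tp; have [mP _] := sP.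
have in0 : 0 \in `[0, T] by rewrite in_itv/= lexx ltW.
have := weak _ _ _ (product_test_HQ mOmega s0 T0 tp Hpsi)
  (product_test_time_derivative mOmega s0 tp Hpsi)
  (product_test_time_value mOmega s0 tp Hpsi in0).
have patchI (h : R -> R) t : I t -> (h \_ I) t = h t by move=> It; rewrite patchE mem_set.
have patchN (h : R -> R) t : ~ I t -> (h \_ I) t = 0 by move=> It; rewrite patchE memNset.
have patch_sep (h : Rn * R -> R) (D : set Rn) (z : Rn * R) :
    ((fun z => h z * product_test theta psi z) \_ (D `*` I)) z =
    (h \_ (D `*` I)) z * (psi z.1 * (theta \_ I) z.2).
  rewrite [LHS]patchE [(h \_ _) _]patchE; case: ifPn => [/set_mem[_ It]|_].
    by rewrite patchI// /product_test; ring.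
  by rewrite mul0r.
rewrite pairing_timeE//; last exact: square_integrable_indic.
rewrite (pairing_timeE (nu := lebxx))//.
move=> weak_eq; etransitivity; last (etransitivity; first exact: weak_eq); last first.
- congr (_ + _ + _).
  + by rewrite Rintegral_mkcond; apply: eq_Rintegral => z _; rewrite patch_sep.
  + by rewrite Rintegral_mkcond; apply: eq_Rintegral => z _; rewrite patch_sep.
- apply: congr_terms.
  + rewrite [RHS]Rintegral_mkcond; apply: eq_Rintegral => t _.
    have [It|It] := pselect (I t); last by rewrite !patchN// mul0r.
    rewrite !patchI//= /product_test_deriv /pivot /=; congr (_ * _).
    rewrite [RHS]Rintegral_mkcond; apply: eq_Rintegral => x _.
    rewrite patchE indicE /slice; case: (x \in Omega); rewrite /= ?mul0r// mul1r.
    by rewrite -[time_restr rho (x, t)]/(slice (time_restr rho) t x) time_restr_slice// /slice mulrC.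
  + rewrite [RHS]Rintegral_mkcond; transitivity (\int[leb]_t
      \int[lebxx]_z (frac_lift (time_restr rho) (z, t) * ((theta \_ I) t * frac_diff Omega s psi z))).
      have [[mF _] [mb _] [mt _]] := And3 sF sfpsi st.
      apply: Rintegral_ae_eq.
      - apply: measurable_funM => //.
        apply: (@measurable_fun_Rintegral _ _ _ _ _ lebxx
          (fun z => frac_lift (time_restr rho) (z.2, z.1) * frac_diff Omega s psi z.2)).
        apply: measurable_funM; last exact: (measurableT_comp mb).
        by apply: (measurableT_comp mF); apply: measurable_fun_pair.
      - apply: (@measurable_fun_Rintegral _ _ _ _ _ lebxx
          (fun z => frac_lift (time_restr rho) (z.2, z.1) *
             ((theta \_ I) z.1 * frac_diff Omega s psi z.2))).
        apply: measurable_funM.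
          by apply: (measurableT_comp mF); apply: measurable_fun_pair.
        by apply: measurable_funM; [exact: (measurableT_comp mt)|exact: (measurableT_comp mb)].
      have := ae_slice_time sF.
      apply: (@filterS _ _ (ae_filter_ringOfSetsType _)) => t sFt.
      rewrite -RintegralZl//=; last exact: (integrable_mul sFt sfpsi).
      by apply: eq_Rintegral => z _; ring.
    apply: eq_Rintegral => t _; have [It|It] := pselect (I t); last first.
      rewrite !patchN//; under eq_Rintegral do rewrite mul0r mulr0.
      by rewrite Rintegral_cst// mul0r.
    have mt : measurable_fun setT (slice (time_restr rho) t).
      exact: (measurableT_comp mP (pair2_measurable t)).
    rewrite !patchI// -(time_restr_slice rho It) F_R_bilinearE//.
      apply: eq_Rintegral => z _; rewrite /frac_lift /=; congr (_ * _).
      by rewrite /frac_diff /slice /product_test /=; ring.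
    rewrite /slice /product_test /=.
    by apply: measurable_funM; [exact: measurable_cst|have [] := spsi].
  + rewrite [RHS]Rintegral_mkcond; apply: eq_Rintegral => -[x t] _.
    rewrite /product_test [RHS]patchE indicE /=.
    have [It|It] := pselect (I t); last first.
      by rewrite patchN// !mulr0 memNset// => -[].
    rewrite patchI//; have [xO|xO] := boolP (x \in ~` Omega).
      rewrite mem_set; last by split => //; exact: set_mem.
      by rewrite /= -[time_restr rho (x, t)]/(slice (time_restr rho) t x) time_restr_slice// /slice; ring.
    rewrite memNset ?mul0r//; last by move=> [/mem_set xO1 _]; rewrite xO1 in xO.
Qed.

Lemma weak_form0 : weak_form (cst 0) (cst 0) (cst 0) (cst 0).
Proof.
move=> theta q psi _ _.
have int0 d (X : measurableType d) (m : {measure set X -> \bar R}) (D : set X)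
    (h : X -> R) : (forall x, h x = 0) -> \int[m]_(x in D) h x = 0.
  by move=> h0; rewrite /Rintegral integral0_eq// => x _; rewrite h0.
rewrite !int0 ?oppr0 ?addr0// => z.
- by rewrite mul0r.
- by rewrite patchE; case: ifP; rewrite mul0r.
- by rewrite patchE; case: ifP; rewrite mul0r.
- by rewrite mulr0 mul0r.
- by rewrite /frac_lift /frac_diff /slice subrr mulr0 mul0r.
- by rewrite mulr0 mul0r.
Qed.

End weak.

(** * The weak inequality for a difference, and time windows *)

Section comparison.
Context (R : realType) (N : nat) (Omega : set 'rV[R]_N) (s T : R).
Local Notation Rn := 'rV[R]_N.
Local Notation lebx := (lebesgue_rV R N).
Local Notation lebxx := (sigma_finite_prod lebx lebx).
Local Notation leb := (@lebesgue_measure R).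
Local Notation I := (`]0, T[%classic : set R).
Hypotheses (mOmega : measurable Omega) (s0 : 0 <= s).
Variables (f g f' g' : Rn * R -> R) (rho0 rho0' : Rn -> R) (P P' : Rn * R -> R).
Hypotheses (L2d : L2_data Omega T f g rho0) (L2d' : L2_data Omega T f' g' rho0').
Hypotheses (sP : square_integrable (lebx \x leb)%E setT P)
  (sF : square_integrable (lebxx \x leb)%E setT (frac_lift Omega s P))
  (sP' : square_integrable (lebx \x leb)%E setT P')
  (sF' : square_integrable (lebxx \x leb)%E setT (frac_lift Omega s P')).
Hypotheses (wf : weak_form Omega s T f g rho0 P)
  (wf' : weak_form Omega s T f' g' rho0' P').
Hypotheses (le_rho0 : {ae lebx, forall x, Omega x -> rho0 x <= rho0' x})
  (le_g : {ae (lebx \x leb)%E, forall z, cylSigma Omega T z -> g z <= g' z})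
  (le_f : {ae (lebx \x leb)%E, forall z, cylQ Omega T z -> f z <= f' z}).

Let u (z : Rn * R) : R := P z - P' z.

Let frac_liftB z : frac_lift Omega s u z = frac_lift Omega s P z - frac_lift Omega s P' z.
Proof. by rewrite /frac_lift /frac_diff /slice /u; ring. Qed.

Lemma frac_liftB_sqi : square_integrable (lebxx \x leb)%E setT (frac_lift Omega s u).
Proof.
have -> : frac_lift Omega s u =
    fun z => frac_lift Omega s P z - frac_lift Omega s P' z by exact/funext/frac_liftB.
exact: square_integrableB.
Qed.

(** Subtraction of two weak forms: the data terms are ordered because theta psi is
    nonnegative. *)
Lemma comparison_inequality (theta q : R -> R) (psi : Rn -> R) :
  profile T theta q -> Hs Omega s psi -> (forall x, 0 <= psi x) ->
  - (\int[(lebx \x leb)%E]_z (\1_Omega z.1 * u z * (psi z.1 * (q \_ I) z.2)))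
  + (\int[(lebxx \x leb)%E]_z
      (frac_lift Omega s u z * (frac_diff Omega s psi z.1 * (theta \_ I) z.2)))
  + (\int[(lebx \x leb)%E]_z
      (\1_(~` Omega) z.1 * u z * (psi z.1 * (theta \_ I) z.2))) <= 0.
Proof.
have arith (a a' b b' c c' k k' l l' r r' : R) : - a + b + c = k + l + r ->
    - a' + b' + c' = k' + l' + r' -> k <= k' -> l <= l' -> r <= r' ->
    - (a - a') + (b - b') + (c - c') <= 0 by lra.
move=> tp Hpsi psi0.
have [st sq] := profile_sqi tp.
have [_ _ t0 _ _] := tp.
have [spsi sfpsi] := (HsP mOmega psi s0).1 Hpsi.
have mOC : measurable (~` Omega) by exact: measurableC.
have mI : measurable I by [].
have e1 := wf tp Hpsi.
have e2 := wf' tp Hpsi.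
have iO := square_integrable_indic mOmega; have iC := square_integrable_indic mOC.
rewrite (pairingB (iO _ sP) spsi sq (iO _ sP'))//; last first.
  by move=> z; rewrite /u mulrBr.
rewrite (pairingB (iC _ sP) spsi st (iC _ sP'))//; last first.
  by move=> z; rewrite /u mulrBr.
rewrite (pairingB sF sfpsi st sF')//.
have [sf sg srho0] := L2d; have [sf' sg' srho0'] := L2d'.
have mQ : measurable (cylQ Omega T) by exact: measurableX.
have mS : measurable (cylSigma Omega T) by exact: measurableX.
have phi0 (z : Rn * R) : 0 <= psi z.1 * (theta \_ I) z.2.
  by rewrite mulr_ge0// patchE; case: ifP.
have data (D : set (Rn * R)%type) (h h' : Rn * R -> R) : measurable D ->
    square_integrable (lebx \x leb)%E D h -> square_integrable (lebx \x leb)%E D h' ->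
    {ae (lebx \x leb)%E, forall z, D z -> h z <= h' z} ->
    \int[(lebx \x leb)%E]_z ((h \_ D) z * (psi z.1 * (theta \_ I) z.2)) <=
    \int[(lebx \x leb)%E]_z ((h' \_ D) z * (psi z.1 * (theta \_ I) z.2)).
  move=> mD sh sh' hh'; apply: ae_le_Rintegral.
  - by apply: integrable_pairing => //; exact: square_integrable_patch.
  - by apply: integrable_pairing => //; exact: square_integrable_patch.
  - move: (hh').
    apply: (@filterS _ _ (ae_filter_ringOfSetsType _)) => z hz.
    rewrite ler_wpM2r// !patchE.
    by case: ifPn => // /set_mem; exact: hz.
have d1 := data _ _ _ mQ sf sf' le_f; have d2 := data _ _ _ mS sg sg' le_g.
have d3 : \int[lebx]_(x in Omega) (rho0 x * (theta 0 * psi x)) <=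
    \int[lebx]_(x in Omega) (rho0' x * (theta 0 * psi x)).
  have s1 := square_integrableZ (theta 0) spsi.
  rewrite Rintegral_mkcond [leRHS]Rintegral_mkcond.
  have pE (h : Rn -> R) : (fun x => h x * (theta 0 * psi x)) \_ Omega =
      fun x => (h \_ Omega) x * (theta 0 * psi x).
    by apply/funext => x; rewrite !patchE; case: ifP; rewrite ?mul0r.
  rewrite !pE; apply: ae_le_Rintegral.
  - by apply: integrable_mul => //; exact: square_integrable_patch.
  - by apply: integrable_mul => //; exact: square_integrable_patch.
  - move: (le_rho0).
    apply: (@filterS _ _ (ae_filter_ringOfSetsType _)) => x hx.
    rewrite ler_wpM2r ?mulr_ge0// !patchE.
    by case: ifPn => // /set_mem; exact: hx.
exact: arith e1 e2 d1 d2 d3.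
Qed.

End comparison.

Section window.
Context (R : realType).
Local Notation leb := (@lebesgue_measure R).

Lemma windowE (h a : R) : 0 <= h -> window h a = \1_(`[a - h, a[%classic).
Proof.
move=> h0; apply/funext => tau; rewrite indicE /window /step.
have -> : (tau \in `[a - h, a[%classic) = (a - h <= tau) && (tau < a).
  by apply/idP/idP; rewrite in_setE/= in_itv.
case: (ltP tau a) => ta; case: (ltP tau (a - h)) => tah /=; rewrite ?subr0 ?subrr//.
by exfalso; move: h0 ta tah; lra.
Qed.

Lemma window_sqr (h a tau : R) : 0 <= h -> window h a tau ^+ 2 = window h a tau.
Proof.
by move=> h0; rewrite windowE// indicE; case: (_ \in _); rewrite ?expr1n ?expr0n.
Qed.

Lemma window_ge0 (h a tau : R) : 0 <= h -> 0 <= window h a tau.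
Proof. by move=> h0; rewrite -window_sqr// sqr_ge0. Qed.

Lemma integral_window (h a : R) : 0 <= h -> (\int[leb]_t (window h a t)%:E = h%:E)%E.
Proof.
move=> h0; rewrite windowE// integral_indic// setIT.
apply: (etrans (lebesgue_measure_itv `[a - h, a[)); rewrite /= lte_fin.
case: ltP => [_|]; first by rewrite -EFinB opprB addrC subrK.
by rewrite lerBrDr -[leRHS]addr0 lerD2l => h1; congr EFin; apply/eqP; rewrite eq_le h0.
Qed.

Lemma window_sqi (h a : R) : 0 <= h -> square_integrable leb setT (window h a).
Proof.
move=> h0; split.
  by rewrite windowE//; exact: measurable_indic.
by under eq_integral do rewrite window_sqr//; rewrite integral_window// ltry.
Qed.

End window.

(** * One time step for a single bilinear term *)

(** With e = D k - th and |e| <= M = D (x + y), the right side minus the left side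
    is (a - c)^2 (M + e) / 4 + (a + c)^2 (M - e) / 4. *)
Lemma mul_le_sqr_avg (R : realFieldType) (D a c k th x y : R) :
  - (D * (x + y)) <= D * k - th -> D * k - th <= D * (x + y) ->
  D * (a * (c * k)) - D / 2 * (x * a ^+ 2 + c ^+ 2 * x) -
    D / 2 * (y * a ^+ 2 + c ^+ 2 * y) <= a * (c * th).
Proof.
move=> H1 H2; rewrite -subr_ge0.
rewrite [leRHS](_ : _ = (a - c) ^+ 2 * (D * (x + y) + (D * k - th)) / 4 +
  (a + c) ^+ 2 * (D * (x + y) - (D * k - th)) / 4); last by field.
apply: addr_ge0; apply: divr_ge0 => //; apply: mulr_ge0; rewrite ?sqr_ge0//.
  by rewrite -lerBlDl sub0r.
by rewrite subr_ge0.
Qed.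

Section energy_step.
Context d (Y : measurableType d) (R : realType) (T : R).
Variable nu : {sigma_finite_measure set Y -> \bar R}.
Local Notation leb := (@lebesgue_measure R).
Local Notation I := (`]0, T[%classic : set R).
Variable A : (Y * R)%type -> R.
Hypothesis sA : square_integrable (nu \x leb)%E setT A.

(** The average of A over the part of [t - h, t[ inside ]0, T[, without the
    factor 1 / h. *)
Definition average (h t : R) (y : Y) : R :=
  \int[leb]_tau ((window h t \_ I) tau * A (y, tau)).

(** Writing the energy spent on a window as an increment of this function of t
    makes the errors of successive time steps telescope. *)
Definition energy_before (t : R) : R :=
  \int[(nu \x leb)%E]_z ((step t z.2 * A z) ^+ 2).

Lemma step_mul_sqi (t : R) :
  square_integrable (nu \x leb)%E setT (fun z => step t z.2 * A z).
Proof.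
have [mA _] := sA; apply: square_integrable_le sA.
  by apply: measurable_funM => //; apply: (measurableT_comp (measurable_step t)).
move=> z; rewrite normrM /step; case: (_ < _) => /=.
  by rewrite normr1 mul1r.
by rewrite normr0 mul0r.
Qed.

Lemma window_mul_sqi (h t : R) :
  square_integrable (nu \x leb)%E setT (fun z => window h t z.2 * A z).
Proof.
have := square_integrableB (step_mul_sqi t) (step_mul_sqi (t - h)).
by under eq_fun do rewrite -mulrBl.
Qed.

Lemma window_energy (h t : R) : 0 <= h ->
  \int[(nu \x leb)%E]_z ((window h t z.2 * A z) ^+ 2) =
  energy_before t - energy_before (t - h).
Proof.
move=> h0; rewrite -RintegralB//; last 2 first.
- exact: (integrable_sqr (step_mul_sqi t)).
- exact: (integrable_sqr (step_mul_sqi (t - h))).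
apply: eq_Rintegral => z _; rewrite exprMn window_sqr// !exprMn -mulrBl.
by rewrite /window /step; case: (_ < _); case: (_ < _); rewrite ?expr1n ?expr0n.
Qed.

Lemma energy_before_ge0 (t : R) : 0 <= energy_before t.
Proof. by apply: Rintegral_ge0 => z _; exact: sqr_ge0. Qed.

Lemma energy_before_le (t : R) :
  energy_before t <= \int[(nu \x leb)%E]_z (A z ^+ 2).
Proof.
apply: le_Rintegral => //.
- exact: (integrable_sqr (step_mul_sqi t)).
- exact: (integrable_sqr sA).
move=> z _; rewrite exprMn /step; case: (_ < _) => /=.
  by rewrite expr1n mul1r.
by rewrite expr0n mul0r sqr_ge0.
Qed.

(** Dominated convergence: at a fixed point the windows [t - 1 / (n + 1), t[ are
    eventually left.  As the windows exclude t, no time is exceptional. *)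
Lemma energy_before_left_cvg (t : R) :
  (energy_before t - energy_before (t - n.+1%:R^-1)) @[n --> \oo] --> 0.
Proof.
pose f n z := ((window n.+1%:R^-1 t z.2 * A z) ^+ 2)%:E.
have [mA _] := sA.
have mf n : measurable_fun setT (f n).
  by apply/measurable_EFinP/measurable_funX; have [] := window_mul_sqi n.+1%:R^-1 t.
have f_cvg : {ae (nu \x leb)%E, forall z, setT z -> f n z @[n --> \oo] --> 0%E}.
  apply: aeW => z _; apply: cvg_near_cst.
  have [zt|tz] := ltP z.2 t; last first.
    apply: nearW => n; rewrite /f /window /step !ltNge tz/=.
    by rewrite (le_trans _ tz) ?gerBl// subrr mul0r expr0n.
  have tz0 : 0 < t - z.2 by rewrite subr_gt0.
  have := near_infty_natSinv_lt (PosNum tz0); apply: filterS => n /= nt.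
  rewrite /f /window /step zt (_ : z.2 < t - n.+1%:R^-1) ?subrr ?mul0r ?expr0n//.
  by rewrite ltrBrDr -ltrBrDl.
have f_dom : {ae (nu \x leb)%E, forall z n, setT z -> (`|f n z| <= (A z ^+ 2)%:E)%E}.
  apply: aeW => z n _; rewrite /f exprMn window_sqr// gee0_abs; last first.
    by rewrite lee_fin mulr_ge0 ?sqr_ge0// window_ge0.
  rewrite lee_fin -[leRHS]mul1r ler_wpM2r ?sqr_ge0// windowE// indicE lern1 leq_b1.
have [_ _] := @dominated_convergence _ _ R (nu \x leb)%E setT measurableT
  f (cst 0%E) (fun z => (A z ^+ 2)%:E) mf (measurable_cst 0%E) f_cvg
  (integrable_sqr sA) f_dom.
rewrite integral0 => /fine_cvgP[_]; apply: cvg_trans; apply: near_eq_cvg.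
by apply: nearW => n /=; rewrite -window_energy// invr_ge0.
Qed.

Lemma tensor_window_energy (b : Y -> R) (h t : R) : 0 <= h ->
  square_integrable nu setT b ->
  \int[(nu \x leb)%E]_z ((b z.1 * window h t z.2) ^+ 2) = h * \int[nu]_y (b y ^+ 2).
Proof.
move=> h0 sb; have sw := window_sqi t h0.
rewrite (Rintegral_fubini1 (integrable_sqr (square_integrable_tensor sb sw))) /=.
rewrite -RintegralZl//; last exact: (integrable_sqr sb).
apply: eq_Rintegral => y _.
under eq_Rintegral do rewrite exprMn.
rewrite RintegralZl//; last exact: (integrable_sqr sw).
by under eq_Rintegral do rewrite window_sqr//; rewrite /Rintegral integral_window//= mulrC.
Qed.

Lemma window_cut_sqi (h t : R) : 0 <= h -> square_integrable leb setT (window h t \_ I).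
Proof.
move=> h0; apply: square_integrable_patch => //.
by apply: (square_integrableS _ _ _ (window_sqi t h0)).
Qed.

Lemma average_sqi (h t : R) : 0 <= h -> square_integrable nu setT (average h t).
Proof.
by move=> h0; apply: square_integrable_time_average => //; exact: window_cut_sqi.
Qed.

(** Replacing the trapezoid by D times the window changes the integrand by at most
    D |A b| <= D (A^2 + b^2) / 2 on two windows of length D; the window itself
    produces the average of A, which is bounded below against b by hypothesis. *)
Lemma pairing_trapezoid_ge (b : Y -> R) (h D t : R) :
  0 <= D -> D <= h -> t <= T -> square_integrable nu setT b ->
  {ae nu, forall y, b y ^+ 2 <= average h t y * b y} ->
  D * \int[nu]_y (b y ^+ 2) -
  D / 2 * ((energy_before t - energy_before (t - D)) +
    (energy_before (t - h) - energy_before (t - h - D)) +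
    2 * (D * \int[nu]_y (b y ^+ 2))) <=
  \int[(nu \x leb)%E]_z (A z * (b z.1 * (trapezoid h D t \_ I) z.2)).
Proof.
have arith (e e' c g : R) :
    D * c - D / 2 * (e + e' + 2 * g) = D * c - D / 2 * (e + g) - D / 2 * (e' + g).
  by field.
move=> D0 Dh tT sb ab.
have h0 : 0 <= h by exact: le_trans Dh.
have sT : square_integrable leb setT (trapezoid h D t \_ I).
  exact: (profile_sqi (trapezoid_profile h0 D0 tT)).1.
have sW := window_cut_sqi t h0.
(* w1 and w2 bound the error on the two slopes, m is the main term *)
pose w1 z := D / 2 * ((window D t z.2 * A z) ^+ 2 + (b z.1 * window D t z.2) ^+ 2).
pose w2 z := D / 2 * ((window D (t - h) z.2 * A z) ^+ 2 +
  (b z.1 * window D (t - h) z.2) ^+ 2).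
pose m z := D * (A z * (b z.1 * (window h t \_ I) z.2)).
have iw a : (nu \x leb)%E.-integrable setT (EFin \o fun z =>
    D / 2 * ((window D a z.2 * A z) ^+ 2 + (b z.1 * window D a z.2) ^+ 2)).
  have := integrableZl measurableT (D / 2) (integrableD measurableT
    (integrable_sqr (window_mul_sqi D a))
    (integrable_sqr (square_integrable_tensor sb (window_sqi a D0)))).
  by apply: eq_integrable.
have im : (nu \x leb)%E.-integrable setT (EFin \o m).
  exact: (integrableZl measurableT D (integrable_pairing sA sb sW)).
have imw : (nu \x leb)%E.-integrable setT (EFin \o (fun z => m z - w1 z)).
  exact: (integrableB measurableT im (iw t)).
have imww : (nu \x leb)%E.-integrable setT (EFin \o (fun z => m z - w1 z - w2 z)).
  exact: (integrableB measurableT imw (iw (t - h))).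
have wE a : \int[(nu \x leb)%E]_z
    (D / 2 * ((window D a z.2 * A z) ^+ 2 + (b z.1 * window D a z.2) ^+ 2)) =
    D / 2 * (energy_before a - energy_before (a - D) + D * \int[nu]_y (b y ^+ 2)).
  have i1 := integrable_sqr (window_mul_sqi D a).
  have i2 := integrable_sqr (square_integrable_tensor sb (window_sqi a D0)).
  rewrite RintegralZl//; last exact: (integrableD measurableT i1 i2).
  by rewrite RintegralD// window_energy// tensor_window_energy.
have mE : \int[(nu \x leb)%E]_z m z = D * \int[nu]_y (average h t y * b y).
  by rewrite RintegralZl//; [rewrite pairing_spaceE|exact: integrable_pairing].
have lb : \int[nu]_y (b y ^+ 2) <= \int[nu]_y (average h t y * b y).
  apply: ae_le_Rintegral ab.
  - exact: integrable_sqr.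
  - by apply: integrable_mul => //; exact: average_sqi.
apply: (@le_trans _ _ (\int[(nu \x leb)%E]_z (m z - w1 z - w2 z))).
  have e1 := RintegralB measurableT imw (iw (t - h)).
  have e2 := RintegralB measurableT im (iw t).
  rewrite (_ : \int[(nu \x leb)%E]_z (m z - w1 z - w2 z) =
    \int[(nu \x leb)%E]_z m z - \int[(nu \x leb)%E]_z w1 z -
    \int[(nu \x leb)%E]_z w2 z); last exact: (etrans e1 (congr1 (fun v => v - _) e2)).
  by rewrite mE !wE arith !lerD2r ler_wpM2l.
apply: le_Rintegral => //; first exact: integrable_pairing.
move=> z _; rewrite /m /w1 /w2.
have [Iz|Iz] := pselect (I z.2); last first.
  rewrite !patchE !memNset// !mulr0 sub0r.
  by rewrite -opprD oppr_le0 addr_ge0// mulr_ge0 ?divr_ge0// addr_ge0// sqr_ge0.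
rewrite !patchE !mem_set//.
have := trapezoid_approx t h0 D0 z.2 Dh.
move: (A z) (b z.1) => a c.
rewrite !exprMn !window_sqr//.
have := window_ge0 t z.2 D0; have := window_ge0 (t - h) z.2 D0.
move: (window D t z.2) (window D (t - h) z.2) (window h t z.2)
  (trapezoid h D t z.2) => x y k th y0 x0; rewrite ler_norml => /andP[H1 H2].
exact: mul_le_sqr_avg.
Qed.

End energy_step.

(** * The energy argument *)

(** The exceptional set is contained in the union of two strips over null
    sets. *)
Lemma ae_prod d d' (X : measurableType d) (Y : measurableType d') (R : realType)
    (m1 : {sigma_finite_measure set X -> \bar R})
    (m2 : {sigma_finite_measure set Y -> \bar R}) (P : X -> Prop) (Q : Y -> Prop) :
  {ae m1, forall x, P x} -> {ae m2, forall y, Q y} ->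
  {ae (m1 \x m2)%E, forall z, P z.1 /\ Q z.2}.
Proof.
move=> [Z [mZ Z0 PZ]] [Z' [mZ' Z'0 QZ]].
have n1 : (m1 \x m2)%E.-negligible (Z `*` setT).
  exists (Z `*` setT); split => //; first exact: measurableX.
  apply: (etrans (product_measure1E m1 m2 mZ measurableT)).
  by rewrite [X in (X * _)%E]Z0; exact: mul0e.
have n2 : (m1 \x m2)%E.-negligible (setT `*` Z').
  exists (setT `*` Z'); split => //; first exact: measurableX.
  by apply: (etrans (product_measure1E m1 m2 measurableT mZ')); rewrite Z'0 mule0.
apply: (negligibleS _ (negligibleU n1 n2)) => z /= nPQ.
have [Pz|nP] := pselect (P z.1); last by left; split => //; exact: PZ.
by right; split => //; apply: QZ => Qz; exact: nPQ.
Qed.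

(** Convexity of the squared positive part. *)
Lemma half_sqr_pos_part (R : realFieldType) (a b : R) :
  2^-1 * Num.max 0 a ^+ 2 - 2^-1 * Num.max 0 b ^+ 2 <=
  a * Num.max 0 a - b * Num.max 0 a.
Proof.
have h2 := sqr_ge0 a; have h3 := sqr_ge0 b.
case: (ltP 0 a) => a0; case: (ltP 0 b) => b0.
- by have h1 := sqr_ge0 (a - b); nra.
- have : a * b <= 0 by rewrite mulr_ge0_le0// ltW.
  by move: h2; nra.
- by rewrite !mulr0 expr0n/= mulr0 sub0r subr0 oppr_le0 mulr_ge0// invr_ge0.
- by rewrite !mulr0 expr0n/= mulr0.
Qed.

Lemma half_sqr_step d (X : measurableType d) (R : realType)
    (m : {measure set X -> \bar R}) (p1 p2 v1 v2 p : X -> R) :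
  square_integrable m setT p1 -> square_integrable m setT p2 ->
  square_integrable m setT v1 -> square_integrable m setT v2 ->
  square_integrable m setT p ->
  (forall x, 2^-1 * p1 x ^+ 2 - 2^-1 * p2 x ^+ 2 <= v1 x * p x - v2 x * p x) ->
  2^-1 * \int[m]_x (p1 x ^+ 2) - 2^-1 * \int[m]_x (p2 x ^+ 2) <=
  \int[m]_x (v1 x * p x) - \int[m]_x (v2 x * p x).
Proof.
move=> /integrable_sqr i1 /integrable_sqr i2 s1 s2 sp le_pv.
have j1 := integrable_mul s1 sp; have j2 := integrable_mul s2 sp.
have k1 := integrableZl measurableT 2^-1 i1.
have k2 := integrableZl measurableT 2^-1 i2.
rewrite -!RintegralZl// -!RintegralB//.
apply: le_Rintegral => //; first exact: (integrableB measurableT k1 k2).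
exact: (integrableB measurableT j1 j2).
Qed.

(** The quadratic error of a time step is absorbed as soon as d <= 1 / 2. *)
Lemma absorb_quadratic_error (R : realFieldType) (d y y' f b w : R) :
  0 < d -> d <= 2^-1 -> 0 <= y -> y' <= 0 -> 0 <= f -> 0 <= b ->
  y - y' + 2 * d * (1 - d) * (f + b) <= d * w -> b <= w.
Proof.
move=> d0 d2 hy hy' f0 hb H.
have H1 : d * (2 * (1 - d) * (f + b)) <= d * w.
  apply: le_trans H; rewrite (_ : 2 * d * (1 - d) * (f + b) =
    d * (2 * (1 - d) * (f + b))); last by ring.
  by rewrite lerDr subr_ge0 (le_trans hy').
rewrite ler_pM2l// in H1; apply: le_trans H1.
apply: (@le_trans _ _ (1 * (f + b))); first by rewrite mul1r lerDr.
rewrite ler_wpM2r ?addr_ge0//.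
by move: d2; lra.
Qed.

Section energy_argument.
Context (R : realType) (N : nat) (Omega : set 'rV[R]_N) (s T : R).
Local Notation Rn := 'rV[R]_N.
Local Notation lebx := (lebesgue_rV R N).
Local Notation lebxx := (sigma_finite_prod lebx lebx).
Local Notation leb := (@lebesgue_measure R).
Local Notation I := (`]0, T[%classic : set R).
Hypotheses (mOmega : measurable Omega) (s0 : 0 <= s).
Variable u : Rn * R -> R.
Hypotheses (su : square_integrable (lebx \x leb)%E setT u)
  (sF : square_integrable (lebxx \x leb)%E setT (frac_lift Omega s u)).
Hypothesis ineq : forall (theta q : R -> R) (psi : Rn -> R),
  profile T theta q -> Hs Omega s psi -> (forall x, 0 <= psi x) ->
  - (\int[(lebx \x leb)%E]_z (\1_Omega z.1 * u z * (psi z.1 * (q \_ I) z.2)))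
  + (\int[(lebxx \x leb)%E]_z
      (frac_lift Omega s u z * (frac_diff Omega s psi z.1 * (theta \_ I) z.2)))
  + (\int[(lebx \x leb)%E]_z
      (\1_(~` Omega) z.1 * u z * (psi z.1 * (theta \_ I) z.2))) <= 0.

Lemma average_indic (D : set Rn) (h t : R) (x : Rn) :
  average T (fun z => \1_D z.1 * u z) h t x = \1_D x * average T u h t x.
Proof.
rewrite /average indicE; case: (_ \in _) => /=.
  by rewrite mul1r; apply: eq_Rintegral => tau _; rewrite mul1r.
by under eq_Rintegral do rewrite mul0r mulr0; rewrite Rintegral_cst// !mul0r.
Qed.

(** Averaging commutes with differences only where u(x, .) and u(y, .) are both
    integrable, that is for almost every pair of points. *)
Lemma average_frac_lift (h t : R) : 0 <= h ->
  {ae lebxx, forall z, average T (frac_lift Omega s u) h t z =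
    frac_diff Omega s (average T u h t) z}.
Proof.
move=> h0; have sW := window_cut_sqi T t h0.
have := ae_prod (ae_slice_space su) (ae_slice_space su).
apply: (@filterS _ _ (ae_filter_ringOfSetsType _)) => -[x y] [/= sx sy].
have ix := integrable_mul sW sx; have iy := integrable_mul sW sy.
rewrite /average /frac_diff /= -RintegralB// -RintegralZl//; last first.
  exact: (integrableB measurableT ix iy).
by apply: eq_Rintegral => tau _; rewrite /frac_lift /frac_diff /slice /=; ring.
Qed.

Definition pos_average (h t : R) (x : Rn) : R := Num.max 0 (average T u h t x).

Lemma pos_average_ge0 (h t : R) (x : Rn) : 0 <= pos_average h t x.
Proof. by rewrite /pos_average le_max lexx. Qed.

Lemma frac_average_sqi (h t : R) : 0 <= h ->
  square_integrable lebxx setT (frac_diff Omega s (average T u h t)).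
Proof.
move=> h0; have [mv _] := average_sqi T su t h0.
apply: (@square_integrable_ae _ _ _ lebxx _ (average T (frac_lift Omega s u) h t)).
- by apply: measurable_frac_diff => //; apply: (measurableT_comp mv).
- by have := average_frac_lift t h0; apply: (@filterS _ _ (ae_filter_ringOfSetsType _)).
- exact: average_sqi.
Qed.

(** Taking positive parts is a contraction of the real line, so it decreases both
    parts of the norm of Hs. *)
Lemma pos_average_Hs (h t : R) : 0 <= h -> Hs Omega s (pos_average h t).
Proof.
move=> h0; have sv := average_sqi T su t h0; have [mv _] := sv.
have mp : measurable_fun setT (pos_average h t) by exact: measurable_maxr.
apply/(HsP mOmega _ s0); split.
  apply: square_integrable_le sv => // x.
  by rewrite /pos_average; case: (ltP 0 (average T u h t x)); rewrite ?normr0.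
apply: square_integrable_le (frac_average_sqi t h0).
  by apply: measurable_frac_diff => //; apply: (measurableT_comp mp).
move=> z; rewrite /frac_diff !normrM ler_wpM2l// /pos_average.
move: (average _ _ _ _ z.1) (average _ _ _ _ z.2) => a b.
by case: (ltP 0 a) => a0; case: (ltP 0 b) => b0; rewrite ?subr0 ?sub0r ?subrr ?normr0//;
  rewrite ?normrN ?(gtr0_norm a0) ?(gtr0_norm b0);
  rewrite ler_normr; apply/orP; (left; lra) || (right; lra).
Qed.

Definition inner_mass (h t : R) : R :=
  \int[lebx]_x ((\1_Omega x * pos_average h t x) ^+ 2).

Definition boundary_mass (h t : R) : R :=
  \int[lebx]_x ((\1_(~` Omega) x * pos_average h t x) ^+ 2).

Definition frac_mass (h t : R) : R :=
  \int[lebxx]_z (frac_diff Omega s (pos_average h t) z ^+ 2).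

Local Notation e1 := (energy_before lebxx (frac_lift Omega s u)).
Local Notation e2 := (energy_before lebx (fun z => \1_(~` Omega) z.1 * u z)).

Lemma indic_sqi (D : set Rn) (w : Rn -> R) : measurable D ->
  square_integrable lebx setT w ->
  square_integrable lebx setT (fun x => \1_D x * w x).
Proof.
move=> mD sw; have [mw _] := sw; apply: square_integrable_le sw.
  by apply: measurable_funM => //; exact: measurable_indic.
move=> x; rewrite normrM indicE; case: (_ \in _) => /=.
  by rewrite normr1 mul1r.
by rewrite normr0 mul0r.
Qed.

(** The implicit Euler step: the trapezoid is the profile and the positive part of
    the average at time t is the function of space.  In both bilinear terms
    (a - b) (a^+ - b^+) >= (a^+ - b^+)^2; the time term is handled by convexity. *)
Lemma energy_step (h D t : R) : 0 <= D -> D <= h -> t <= T ->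
  inner_mass h t - inner_mass h (t - D)
  + 2 * D * (1 - D) * (frac_mass h t + boundary_mass h t)
  <= D * ((e1 t - e1 (t - D)) + (e1 (t - h) - e1 (t - h - D)) +
          ((e2 t - e2 (t - D)) + (e2 (t - h) - e2 (t - h - D)))).
Proof.
have arith (y y' b1 b2 E1 E2 a0 a1 a2 : R) :
    D * b1 - D / 2 * (E1 + 2 * (D * b1)) <= a1 ->
    D * b2 - D / 2 * (E2 + 2 * (D * b2)) <= a2 ->
    2^-1 * y - 2^-1 * y' <= a0 -> a0 + a1 + a2 <= 0 ->
    y - y' + 2 * D * (1 - D) * (b1 + b2) <= D * (E1 + E2).
  move=> h1 h2 h3 h4.
  rewrite (_ : D / 2 * (E1 + _) = D * E1 / 2 + D * (D * b1)) in h1; last by field.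
  rewrite (_ : D / 2 * (E2 + _) = D * E2 / 2 + D * (D * b2)) in h2; last by field.
  rewrite (_ : 2 * D * (1 - D) * (b1 + b2) = 2 * (D * b1) + 2 * (D * b2) -
    2 * (D * (D * b1)) - 2 * (D * (D * b2))); last by ring.
  rewrite (_ : D * (E1 + E2) = D * E1 + D * E2); last by ring.
  by move: h1 h2 h3 h4; lra.
move=> D0 Dh tT; have h0 : 0 <= h by exact: le_trans Dh.
have mOC : measurable (~` Omega) by exact: measurableC.
have HH := pos_average_Hs t h0.
have [sp sfp] := (HsP mOmega _ s0).1 HH.
have := ineq (trapezoid_profile h0 D0 tT) HH (pos_average_ge0 h t).
apply: arith.
- apply: pairing_trapezoid_ge => //.
  have := average_frac_lift t h0; apply: (@filterS _ _ (ae_filter_ringOfSetsType _)).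
  move=> z ->; rewrite /frac_diff /pos_average.
  move: (average _ _ _ _ z.1) (average _ _ _ _ z.2) (frac_weight _ _ z) => a b w.
  rewrite -subr_ge0 (_ : _ - _ = w ^+ 2 * ((Num.max 0 a - Num.max 0 b) *
    ((a - Num.max 0 a) - (b - Num.max 0 b)))); last by ring.
  rewrite mulr_ge0 ?sqr_ge0//.
  by case: (ltP 0 a) => a0; case: (ltP 0 b) => b0; nra.
- rewrite [leRHS](_ : _ = \int[(lebx \x leb)%E]_z (\1_(~` Omega) z.1 * u z *
    ((\1_(~` Omega) z.1 * pos_average h t z.1) * (trapezoid h D t \_ I) z.2))); last first.
    apply: eq_Rintegral => z _; rewrite indicE; case: (_ \in _) => /=; rewrite ?mul1r//.
    by rewrite !mul0r.
  apply: pairing_trapezoid_ge => //; first exact: square_integrable_indic.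
    exact: indic_sqi.
  apply: aeW => x; rewrite average_indic indicE /pos_average.
  by case: (_ \in _); case: (ltP 0 (average T u h t x)) => v0 /=; nra.
have sA0 := square_integrable_indic mOmega su.
have sW1 := window_cut_sqi T t h0; have sW2 := window_cut_sqi T (t - D) h0.
have i1 := integrable_pairing sA0 sp sW1; have i2 := integrable_pairing sA0 sp sW2.
have -> : - (\int[(lebx \x leb)%E]_z (\1_Omega z.1 * u z *
      (pos_average h t z.1 * (trapezoid_deriv h D t \_ I) z.2))) =
    \int[(lebx \x leb)%E]_z (\1_Omega z.1 * u z *
      (pos_average h t z.1 * (window h t \_ I) z.2)) -
    \int[(lebx \x leb)%E]_z (\1_Omega z.1 * u z *
      (pos_average h t z.1 * (window h (t - D) \_ I) z.2)).
  rewrite -RintegralB// -mulN1r -RintegralZl//; last first.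
    exact: (integrable_pairing sA0 sp (profile_sqi (trapezoid_profile h0 D0 tT)).2).
  apply: eq_Rintegral => z _; rewrite !patchE; case: ifP => _.
    by rewrite /trapezoid_deriv; ring.
  by rewrite !mulr0 subrr.
rewrite !(pairing_spaceE sA0 sp)//.
have av t' : (fun y => (\int[leb]_tau ((window h t' \_ I) tau * (\1_Omega y * u (y, tau)))) *
    pos_average h t y) = (fun y => (\1_Omega y * average T u h t' y) * pos_average h t y).
  by apply/funext => y; rewrite -average_indic.
rewrite /= !av.
have sv t' := indic_sqi mOmega (average_sqi T su t' h0).
have sO t' := indic_sqi mOmega ((HsP mOmega _ s0).1 (pos_average_Hs t' h0)).1.
apply: (half_sqr_step (sO t) (sO (t - D)) (sv t) (sv (t - D)) sp) => x.
rewrite indicE /pos_average; case: (_ \in _) => /=.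
  by rewrite !mul1r; exact: half_sqr_pos_part.
by rewrite !mul0r expr0n mulr0 subrr.
Qed.

Let mOC : measurable (~` Omega). Proof. exact: measurableC. Qed.

Let sC : square_integrable (lebx \x leb)%E setT (fun z => \1_(~` Omega) z.1 * u z).
Proof. exact: square_integrable_indic. Qed.

Let E t h := e1 t + e1 (t - h) + (e2 t + e2 (t - h)).

Lemma mass_ge0 (h t : R) :
  [/\ 0 <= inner_mass h t, 0 <= frac_mass h t & 0 <= boundary_mass h t].
Proof. by split; apply: Rintegral_ge0 => x _; exact: sqr_ge0. Qed.

Lemma inner_mass0 (h : R) : 0 <= h -> inner_mass h 0 = 0.
Proof.
move=> h0; rewrite /inner_mass.
have p0 x : pos_average h 0 x = 0.
  rewrite /pos_average /average (_ : Rintegral _ _ _ = 0) ?maxxx//.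
  rewrite (@eq_Rintegral _ _ _ leb setT (cst 0)) ?Rintegral_cst ?mul0r//.
  move=> tau _ /=; rewrite patchE; case: ifPn => [/set_mem/=|]; last by rewrite mul0r.
  rewrite in_itv/= => /andP[tau0 _]; rewrite /window /step ltNge (ltW tau0)/=.
  by rewrite ltNge (le_trans _ (ltW tau0)) ?subrr ?mul0r// sub0r oppr_le0.
under eq_Rintegral do rewrite p0 mulr0 expr0n/=.
by rewrite Rintegral_cst// mul0r.
Qed.

(** The errors of [energy_step] are increments of E, so they add up to D E. *)
Lemma inner_mass_grid (h D : R) (k : nat) : 0 <= D -> D <= h -> D <= 1 ->
  k%:R * D <= T -> inner_mass h (k%:R * D) <= D * E (k%:R * D) h.
Proof.
move=> D0 Dh D1; have h0 : 0 <= h by exact: le_trans Dh.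
have arith (y y' b c c' : R) : 0 <= b -> y' <= D * c' ->
    y - y' + 2 * D * (1 - D) * b <= D * (c - c') -> y <= D * c.
  move=> b0 yc'; have : 0 <= 2 * D * (1 - D) * b.
    by rewrite !mulr_ge0// subr_ge0.
  by move: (2 * D * (1 - D) * b) => g; rewrite mulrBr; move: yc'; lra.
elim: k => [_|k IH kT].
  rewrite mul0r inner_mass0// mulr_ge0// /E.
  by rewrite !addr_ge0// energy_before_ge0.
have kDE : k.+1%:R * D - D = k%:R * D by rewrite -natr1; ring.
have [_ b1 b2] := mass_ge0 h (k.+1%:R * D).
apply: (arith _ (inner_mass h (k%:R * D)) (frac_mass h (k.+1%:R * D) +
  boundary_mass h (k.+1%:R * D)) _ (E (k%:R * D) h)).
- exact: addr_ge0.
- by apply: IH; apply: le_trans kT; rewrite ler_wpM2r// ler_nat.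
- have := energy_step D0 Dh kT; rewrite (addrAC _ (- h)) kDE.
  move/le_trans; apply; rewrite /E.
  move: (e1 _) (e1 _) (e1 _) (e1 _) (e2 _) (e2 _) (e2 _) (e2 _) => *.
  by rewrite ler_wpM2l// le_eqVlt; apply/orP; left; apply/eqP; ring.
Qed.

(** The total energy bounds E uniformly, and the mesh t / k is arbitrarily
    small. *)
Lemma inner_mass_le0 (h t : R) : 0 < h -> 0 <= t <= T -> inner_mass h t <= 0.
Proof.
move=> h0 /andP[t0 tT]; rewrite leNgt; apply/negP => y0.
(* each of the two energies occurs twice in E *)
pose K := 2 * \int[(lebxx \x leb)%E]_z (frac_lift Omega s u z ^+ 2) +
  2 * \int[(lebx \x leb)%E]_z ((\1_(~` Omega) z.1 * u z) ^+ 2).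
have EK t' : E t' h <= K.
  rewrite /E /K !mulr_natl !mulr2n.
  by rewrite !lerD// (energy_before_le sF, energy_before_le sC).
have K0 : 0 <= K.
  by rewrite /K addr_ge0// mulr_ge0// Rintegral_ge0// => z _; exact: sqr_ge0.
pose y := inner_mass h t.
(* k is large enough for the mesh t / k to be admissible in [inner_mass_grid]
   and for the resulting bound t K / k to be smaller than y *)
pose k := (Num.truncn (t * K / y + t / h + t)).+1.
have kgt : t * K / y + t / h + t < k%:R by exact: truncnS_gt.
have a0 : 0 <= t * K / y by rewrite divr_ge0 ?mulr_ge0// ltW.
have b0 : 0 <= t / h by rewrite divr_ge0// ltW.
have k0 : 0 < k%:R :> R by rewrite ltr0n.
have kE : k%:R * (t / k%:R) = t by rewrite mulrC divfK// gt_eqF.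
have D0 : 0 <= t / k%:R by rewrite divr_ge0// ltW.
have Dh : t / k%:R <= h.
  rewrite ler_pdivrMr// mulrC -ler_pdivrMr//.
  by move: (t / h) (t * K / y) a0 b0 kgt t0 => *; lra.
have D1 : t / k%:R <= 1.
  rewrite ler_pdivrMr// mul1r.
  by move: (t / h) (t * K / y) a0 b0 kgt t0 => *; lra.
have := inner_mass_grid D0 Dh D1; move=> /(_ k); rewrite kE => /(_ tT).
apply/negP; rewrite -ltNge.
apply: (@le_lt_trans _ _ (t / k%:R * K)); first by rewrite ler_wpM2l.
rewrite mulrAC ltr_pdivrMr// [ltRHS]mulrC -ltr_pdivrMr// -/y.
by move: (t / h) (t * K / y) a0 b0 kgt t0 => *; lra.
Qed.

(** With the time term gone, a step of length D bounds the mass by the energy spent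
    on windows of length D, which tends to 0. *)
Lemma boundary_mass_le0 (h t : R) : 0 < h -> 0 < t <= T -> boundary_mass h t <= 0.
Proof.
move=> h0 /andP[t0 tT].
pose D n : R := n.+1%:R^-1.
have c1 := energy_before_left_cvg sF t; have c2 := energy_before_left_cvg sF (t - h).
have c3 := energy_before_left_cvg sC t; have c4 := energy_before_left_cvg sC (t - h).
pose W n := (e1 t - e1 (t - D n)) + (e1 (t - h) - e1 (t - h - D n)) +
  ((e2 t - e2 (t - D n)) + (e2 (t - h) - e2 (t - h - D n))).
have cW : W n @[n --> \oo] --> (0 : R).
  have -> : (0 : R) = 0 + 0 + (0 + 0) by rewrite !addr0.
  exact: cvgD (cvgD c1 c2) (cvgD c3 c4).
have near_le (a : R) : 0 < a -> \forall n \near \oo, D n <= a.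
  move=> a0; have := near_infty_natSinv_lt (PosNum a0).
  by apply: filterS => n /= /ltW.
apply: (@ler_cvg_to nat \oo eventually_filter R (fun=> boundary_mass h t) W _ 0 (@cvg_cst _ _ _ _ _) cW).
have half0 : 0 < 2^-1 :> R by rewrite invr_gt0.
move: (near_le _ h0) (near_le _ half0) (near_le _ t0).
apply: (@filterS3 _ _ eventually_filter) => n Dh D2 Dt.
have D0 : 0 < D n by rewrite invr_gt0.
have [y0 b1 b2] := mass_ge0 h t.
have y0' : inner_mass h (t - D n) <= 0.
  apply: inner_mass_le0 => //; rewrite subr_ge0 Dt/= (le_trans _ tT)// gerBl.
  exact: ltW.
have := energy_step (ltW D0) Dh tT.
rewrite -/(D n).
exact: absorb_quadratic_error.
Qed.

Lemma average_le0 (h t : R) : 0 < h -> 0 < t <= T ->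
  {ae lebx, forall x, average T u h t x <= 0}.
Proof.
move=> h0 tT; have sp := ((HsP mOmega _ s0).1 (pos_average_Hs t (ltW h0))).1.
have yO : inner_mass h t <= 0.
  by apply: inner_mass_le0 => //; case/andP: tT => /ltW -> ->.
have := boundary_mass_le0 h0 tT.
move=> /(Rintegral_sqr_eq0 (indic_sqi mOC sp)) zC.
have := Rintegral_sqr_eq0 (indic_sqi mOmega sp) yO.
move: zC; apply: (@filterS2 _ _ (ae_filter_ringOfSetsType _)) => x.
have -> : (\1_(~` Omega) x : R) = 1 - \1_Omega x.
  rewrite !indicE in_setC; case: (x \in Omega) => /=; first by rewrite subrr.
  by rewrite subr0.
move=> p1 p2; have : pos_average h t x = 0 by move: p1; rewrite mulrBl mul1r p2 subr0.
by rewrite /pos_average => <-; rewrite le_max lexx orbT.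
Qed.

End energy_argument.

(** * From time averages to pointwise values *)

Section differentiation.
Context (R : realType) (T : R).
Local Notation leb := (@lebesgue_measure R).
Local Notation I := (`]0, T[%classic : set R).

(** At a Lebesgue point t where w is positive the primitive of w increases strictly
    through t, which contradicts its monotonicity on rational points. *)
Lemma ae_le0_of_windows (w : R -> R) : square_integrable leb setT w ->
  0 < T ->
  (forall p q : rat, 0 < ratr p :> R -> ratr p < ratr q :> R -> ratr q <= T ->
    \int[leb]_tau ((window (ratr q - ratr p) (ratr q) \_ I) tau * w tau) <= 0) ->
  {ae leb, forall t, I t -> w t <= 0}.
Proof.
move=> sw T0 wle; have [mw _] := sw.
pose g := w \_ I.
have mI : measurable I by [].
have sg : square_integrable leb setT g.
  by apply: square_integrable_patch => //; apply: (square_integrableS _ _ _ sw).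
have ig : leb.-integrable setT (EFin \o g).
  have := integrable_mul sg (window_sqi T (ltW T0)); apply: eq_integrable => // t _ /=.
  rewrite /g patchE; case: ifPn => [/set_mem/=|]; last by rewrite mul0r.
  rewrite in_itv/= => /andP[t0 tT].
  by rewrite /window /step tT subrr ltNge (ltW t0) subr0 mulr1.
have igy y : leb.-integrable `]-oo, y] (EFin \o g).
  by apply: integrableS ig.
have lg : locally_integrable [set: R] g.
  by apply: open_integrable_locally => //; exact: openT.
pose F x := \int[leb]_(t in `]-oo, x]) g t.
have FE (p q : R) : p < q ->
    F q - F p = \int[leb]_tau ((window (q - p) q \_ I) tau * w tau).
  move=> pq.
  have Fw a : F a = \int[leb]_tau (step a tau * g tau).
    rewrite /F; transitivity (\int[leb]_(tau in `]-oo, a[) g tau).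
      rewrite /Rintegral -(integral_itv_bndo_bndc (a := -oo%O))//.
      by apply/measurable_EFinP; apply: measurable_funTS; exact: (proj1 sg).
    rewrite Rintegral_mkcond; apply: eq_Rintegral => tau _.
    rewrite patchE /step; case: ifPn => [/set_mem/=|].
      by rewrite in_itv/= => ->; rewrite mul1r.
    move=> /negP h; case: ltP => ta; last by rewrite mul0r.
    by exfalso; apply: h; rewrite mem_set//= in_itv.
  have istep a : leb.-integrable setT (EFin \o (fun tau => step a tau * g tau)).
    apply: le_integrable ig => //.
      apply/measurable_EFinP/measurable_funM; first exact: measurable_step.
      exact: (proj1 sg).
    move=> tau _ /=; rewrite lee_fin normrM /step; case: (_ < _) => /=.
      by rewrite normr1 mul1r.
    by rewrite normr0 mul0r.
  rewrite !Fw -RintegralB//; apply: eq_Rintegral => tau _.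
  rewrite /g !patchE; case: ifP => _; last by rewrite !mulr0 mul0r subrr.
  by rewrite /window subKr mulrBl.
have := FTC1Ny igy lg; apply: (@filterS _ _ (ae_filter_ringOfSetsType _)).
move=> t [dF Ft] It; rewrite leNgt; apply/negP => wt.
have gt : 0 < g t by rewrite /g patchE mem_set.
have cvgF : h^-1 *: (F (h + t) - F t) @[h --> 0^'] --> g t.
  rewrite -Ft /derive1; move: dF; rewrite /derivable.
  rewrite (_ : (fun h => h^-1 *: ((F \o shift t) (h *: 1) - F t)) =
    (fun h => h^-1 *: (F (h + t) - F t)) :> (R -> R))//.
  by apply/funext => h; rewrite /= [h *: 1]mulr1.
have : \forall h \near 0^', 0 < h^-1 *: (F (h + t) - F t).
  exact: (cvgr_gt _ cvgF).
move=> /nbhs_ballP[e /= e0 He].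
move: It; rewrite /= in_itv/= => /andP[t0 tT].
have [q qt] : exists q : rat, t < ratr q < Num.min (t + e) T.
  have /rat_in_itvoo[q] : t < Num.min (t + e) T by rewrite lt_min tT ltrDl e0.
  by rewrite in_itv/=; exists q.
have [p pt] : exists p : rat, Num.max 0 (t - e) < ratr p < t.
  have /rat_in_itvoo[p] : Num.max 0 (t - e) < t by rewrite gt_max t0 gtrBl.
  by rewrite in_itv/=; exists p.
move: qt; rewrite lt_min => /and3P[tq qe qT].
move: pt; rewrite gt_max => /andP[/andP[p0 pe] pt].
have near_incr (r : R) : `|r - t| < e -> r != t -> 0 < (r - t)^-1 * (F r - F t).
  move=> rt rnt; have := He (r - t); rewrite /ball/= sub0r normrN => /(_ rt).
  by rewrite subr_eq0 subrK; apply.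
have Fq : F t < F (ratr q).
  have := near_incr (ratr q); rewrite gtr0_norm ?subr_gt0// ltrBlDl => /(_ qe).
  by rewrite gt_eqF// => /(_ isT); rewrite pmulr_rgt0 ?invr_gt0 ?subr_gt0.
have Fp : F (ratr p) < F t.
  have := near_incr (ratr p); rewrite ltr0_norm ?subr_lt0// opprB ltrBlDr -ltrBlDl => /(_ pe).
  by rewrite lt_eqF// => /(_ isT); rewrite nmulr_rgt0 ?invr_lt0 ?subr_lt0.
have := wle p q p0 (lt_trans pt tq) (ltW qT).
rewrite -FE ?(lt_trans pt)// leNgt subr_gt0 => /negP; apply.
exact: lt_trans Fp Fq.
Qed.
End differentiation.

(** * The comparison principle *)

Lemma ae_of_sections d d' (X : measurableType d) (Y : measurableType d') (R : realType)
    (m1 : {sigma_finite_measure set X -> \bar R})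
    (m2 : {sigma_finite_measure set Y -> \bar R}) (S : set (X * Y)%type) :
  measurable S -> {ae m1, forall x, {ae m2, forall y, ~ S (x, y)}} ->
  {ae (m1 \x m2)%E, forall z, ~ S z}.
Proof.
move=> mS aeS; exists S; split => //; last by move=> z /= /contrapT.
apply: (@etrans _ _ (\int[m1]_x (cst 0 x))%E); last by rewrite integral0.
apply: ge0_ae_eq_integral => //.
  exact: measurable_fun_xsection.
move: aeS; apply: (@filterS _ _ (ae_filter_ringOfSetsType _)) => x nS _ /=.
apply/(measure_negligible (measurable_xsection x mS)).
move: nS; apply: negligibleS => y /=; rewrite /xsection/= => /set_mem Sxy nSxy.
exact: nSxy.
Qed.

Lemma ae_countable d (X : measurableType d) (R : realType) (K : countType)
    (m : {measure set X -> \bar R}) (P : K -> X -> Prop) :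
  (forall k, {ae m, forall x, P k x}) -> {ae m, forall x, forall k, P k x}.
Proof.
move=> aeP.
have /ae_foralln : forall n, {ae m, forall x, forall k, unpickle n = Some k -> P k x}.
  move=> n; case: (unpickle n) => [k|]; last by apply: aeW.
  by have := aeP k; apply: filterS => x Pk _ [<-].
by apply: filterS => x Px k; apply: (Px (pickle k)); exact: pickleK.
Qed.

Section comparison_principle.
Context (R : realType) (N : nat) (Omega : set 'rV[R]_N) (s T : R).
Local Notation Rn := 'rV[R]_N.
Local Notation lebx := (lebesgue_rV R N).
Local Notation lebxx := (sigma_finite_prod lebx lebx).
Local Notation leb := (@lebesgue_measure R).
Local Notation I := (`]0, T[%classic : set R).
Hypotheses (mOmega : measurable Omega) (s0 : 0 <= s) (T0 : 0 < T).

(** The endpoints 0 and T form a null set of times. *)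
Lemma ae_inner_time (P : Rn * R -> Prop) :
  {ae (lebx \x leb)%E, forall z, I z.2 -> P z} ->
  {ae (lebx \x leb)%E, forall z, (setT `*` `[0, T]%classic) z -> P z}.
Proof.
have end_null (c : R) : {ae (lebx \x leb)%E, forall z, z.2 <> c}.
  exists (setT `*` [set c]); split.
  - exact: measurableX.
  - apply: (etrans (product_measure1E lebx leb measurableT (measurable_set1 c))).
    by rewrite [X in (_ * X)%E]lebesgue_measure_set1 mule0.
  - by move=> z /= /contrapT.
move: (end_null 0) (end_null T).
apply: (@filterS3 _ _ (ae_filter_ringOfSetsType _)) => z z0 zT Pz [_ /=].
rewrite in_itv/= => /andP[h0 hT]; apply: Pz; rewrite /= in_itv/=.
by rewrite !lt_neqAle h0 hT !andbT; apply/andP; split; apply/eqP => // /esym.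
Qed.

Lemma comparison_principle (f g f' g' : Rn * R -> R) (rho0 rho0' : Rn -> R)
    (P P' : Rn * R -> R) :
  L2_data Omega T f g rho0 -> L2_data Omega T f' g' rho0' ->
  square_integrable (lebx \x leb)%E setT P ->
  square_integrable (lebxx \x leb)%E setT (frac_lift Omega s P) ->
  square_integrable (lebx \x leb)%E setT P' ->
  square_integrable (lebxx \x leb)%E setT (frac_lift Omega s P') ->
  weak_form Omega s T f g rho0 P -> weak_form Omega s T f' g' rho0' P' ->
  {ae lebx, forall x, Omega x -> rho0 x <= rho0' x} ->
  {ae (lebx \x leb)%E, forall z, cylSigma Omega T z -> g z <= g' z} ->
  {ae (lebx \x leb)%E, forall z, cylQ Omega T z -> f z <= f' z} ->
  {ae (lebx \x leb)%E, forall z, I z.2 -> P z <= P' z}.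
Proof.
move=> L2d L2d' sP sF sP' sF' wf wf' le0 leg lef.
have su := square_integrableB sP sP'; have sFu := frac_liftB_sqi sF sF'.
have ineq := comparison_inequality mOmega s0 L2d L2d' sP sF sP' sF' wf wf' le0 leg lef.
set u := fun z => P z - P' z in su.
have windows : {ae lebx, forall x, forall pq : rat * rat,
    0 < ratr pq.1 :> R -> ratr pq.1 < ratr pq.2 :> R -> ratr pq.2 <= T ->
    average T u (ratr pq.2 - ratr pq.1) (ratr pq.2) x <= 0}.
  apply: ae_countable => -[p q] /=.
  have [p0|p0] := ltP 0 (ratr p : R); last by apply: aeW.
  have [pq|pq] := ltP (ratr p : R) (ratr q); last by apply: aeW.
  have [qT|qT] := leP (ratr q : R) T; last by apply: aeW.
  have h0 : 0 < ratr q - ratr p :> R by rewrite subr_gt0.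
  have qr : 0 < (ratr q : R) <= T by rewrite qT (lt_trans p0 pq).
  have := average_le0 mOmega s0 su sFu ineq h0 qr.
  by apply: (@filterS _ _ (ae_filter_ringOfSetsType _)).
have sections : {ae lebx, forall x, {ae leb, forall t, I t -> u (x, t) <= 0}}.
  move: windows (ae_slice_space su).
  apply: (@filterS2 _ _ (ae_filter_ringOfSetsType _)) => x wx sx.
  by apply: ae_le0_of_windows => // p q; exact: (wx (p, q)).
pose S := [set z : (Rn * R)%type | I z.2 /\ 0 < u z].
have mS : measurable S.
  have [mu _] := su.
  have -> : S = (snd @^-1` I) `&` (u @^-1` `]0, +oo[%classic).
    by apply/seteqP; split => z /=; rewrite !in_itv/= andbT.
  apply: measurableI.
    by rewrite -[X in measurable X]setTI; apply: measurable_snd.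
  by rewrite -[X in measurable X]setTI; apply: mu.
have := @ae_of_sections _ _ _ _ _ lebx leb S mS.
have secS : {ae lebx, forall x, {ae leb, forall t, ~ S (x, t)}}.
  move: sections; apply: (@filterS _ _ (ae_filter_ringOfSetsType _)) => x.
  apply: (@filterS _ _ (ae_filter_ringOfSetsType _)) => t ut [/= It].
  by rewrite ltNge ut.
move=> /(_ secS); apply: (@filterS _ _ (ae_filter_ringOfSetsType _)) => -[x t] nS It.
rewrite leNgt; apply/negP => lt_P; apply: nS; split => //.
by rewrite /u subr_gt0.
Qed.

End comparison_principle.

Theorem corollary4p6 (R : realType) (N : nat) (Omega : set 'rV[R]_N)
    (s T : R) :
  (1 <= N)%N -> bounded_lipschitz_domain Omega -> 0 < s < 1 -> 0 < T ->
  (forall (f g f' g' : 'rV[R]_N * R -> R) (rho0 rho0' : 'rV[R]_N -> R)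
      (rho rho' : 'rV[R]_N * R -> R),
    L2_data Omega T f g rho0 -> L2_data Omega T f' g' rho0' ->
    weak_solution Omega s T f g rho0 rho ->
    weak_solution Omega s T f' g' rho0' rho' ->
    {ae lebesgue_rV R N, forall x, Omega x -> rho0 x <= rho0' x} ->
    {ae (lebesgue_rV R N \x @lebesgue_measure R)%E,
      forall z, cylSigma Omega T z -> g z <= g' z} ->
    {ae (lebesgue_rV R N \x @lebesgue_measure R)%E,
      forall z, cylQ Omega T z -> f z <= f' z} ->
    {ae (lebesgue_rV R N \x @lebesgue_measure R)%E,
      forall z, (setT `*` `[0, T]%classic) z -> rho z <= rho' z}) /\
  (forall (f g : 'rV[R]_N * R -> R) (rho0 : 'rV[R]_N -> R)
      (rho : 'rV[R]_N * R -> R),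
    L2_data Omega T f g rho0 ->
    weak_solution Omega s T f g rho0 rho ->
    {ae (lebesgue_rV R N \x @lebesgue_measure R)%E,
      forall z, cylSigma Omega T z -> 0 <= g z} ->
    {ae (lebesgue_rV R N \x @lebesgue_measure R)%E,
      forall z, cylQ Omega T z -> 0 <= f z} ->
    {ae lebesgue_rV R N, forall x, Omega x -> 0 <= rho0 x} ->
    {ae (lebesgue_rV R N \x @lebesgue_measure R)%E,
      forall z, (setT `*` `[0, T]%classic) z -> 0 <= rho z}).
Proof.
move=> _ [oOmega _ _ _ _] /andP[/ltW s0 _] T0.
have mOmega := open_measurable_rV oOmega.
have rE (rho : 'rV[R]_N * R -> R) z : `]0, T[%classic z.2 -> time_restr T rho z = rho z.
  by case: z => x t It; rewrite -[LHS]/(slice (time_restr T rho) t x) time_restr_slice.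
split=> [f g f' g' rho0 rho0' rho rho' L2d L2d' sol sol' le0 leg lef|
    f g rho0 rho L2d sol g0 f0 rho00].
- have [[L2rho _] _] := sol; have [[L2rho' _] _] := sol'.
  have [sP sF] := L2_Hs_time_restr mOmega s0 L2rho.
  have [sP' sF'] := L2_Hs_time_restr mOmega s0 L2rho'.
  apply: ae_inner_time => //.
  have := comparison_principle mOmega s0 T0 L2d L2d' sP sF sP' sF'
    (weak_solution_weak_form mOmega s0 T0 sol)
    (weak_solution_weak_form mOmega s0 T0 sol') le0 leg lef.
  apply: (@filterS _ _ (ae_filter_ringOfSetsType _)) => z le_z It.
  by have := le_z It; rewrite !rE.
- have [[L2rho _] _] := sol.
  have [sP sF] := L2_Hs_time_restr mOmega s0 L2rho.
  have si0 d (X : measurableType d) (m : {measure set X -> \bar R}) (D : set X) :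
      square_integrable m D (cst 0 : X -> R).
    by split=> //; rewrite integral0_eq// => x _; rewrite expr0n.
  have sF0 : square_integrable
      (sigma_finite_prod (lebesgue_rV R N) (lebesgue_rV R N) \x @lebesgue_measure R)%E
      setT (frac_lift Omega s (cst 0)).
    rewrite (_ : frac_lift _ _ _ = cst 0); first exact: si0.
    by apply/funext => z; rewrite /frac_lift /frac_diff /slice subrr mulr0.
  apply: ae_inner_time => //.
  have L2d0 : L2_data Omega T (cst 0) (cst 0) (cst 0) by split; exact: si0.
  have := comparison_principle mOmega s0 T0 L2d0 L2d (si0 _ _ _ _) sF0 sP sF
    (@weak_form0 _ _ Omega s T) (weak_solution_weak_form mOmega s0 T0 sol) rho00 g0 f0.
  apply: (@filterS _ _ (ae_filter_ringOfSetsType _)) => z le_z It.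
  by have := le_z It; rewrite rE.
Qed.
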